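(* Let $\Xi:\mathbb{R}^n\to\mathfrak{a}^\perp\cap\mathfrak{p}$ be a solution of the $U/K$-system defined by $\mathfrak{a}$, and $\Phi_\lambda$ an extended flat frame for its Lax pair $\theta_\lambda=\sum_{i=1}^n(\lambda a_i+[a_i,\Xi])\,dx_i$. Then: 1. $\Phi_0$ is of the form $\begin{pmatrix}g_1&0\\ 0&g_2\end{pmatrix}$, and if $\mathbf{c}\in\mathbb{R}^{n-1,1}$ is a constant non-zero null vector, then $F_{\mathbf{c}}:=\Phi_1\begin{pmatrix}0\\ g_2^{-1}\mathbf{c}\end{pmatrix}$ is (locally) a flat lift of a conformally flat immersion into $S^{2n-2}$. 2. $F_{\mathbf{c}}$, its fundamental forms and its curvature normals $v_i$ are given explicitly by $$F_{\mathbf{c}}=\sum_{i=1}^nq_i\mathbf{u}_i,\quad \mathrm{I}_{F_{\mathbf{c}}}=\sum_{i=1}^nq_i^2\,dx_i^2,\quad \mathbb{II}_{F_{\mathbf{c}}}=\sum_{i=1}^nq_i\,dx_i^2\,\mathbf{u}_i,\quad v_i=q_i^{-1}\mathbf{u}_i,$$ where $\Phi_1=(\mathbf{e}_1,\dots,\mathbf{e}_n,\mathbf{u}_1,\dots,\mathbf{u}_n)$ and $g_2^{-1}\mathbf{c}=(q_1,\dots,q_n)^T$. 3. If $\mathbf{b}$ is another non-zero null vector in $\mathbb{R}^{n-1,1}$, then $F_{\mathbf{c}}(x)\mapsto F_{\mathbf{b}}(x)$ is a Combescure transform, and it is a Christoffel transform if $h(g_2^{-1}\mathbf{b})$ and $h(g_2^{-1}\mathbf{c})$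 have opposite signs, where $h(y)=\prod_{i=1}^ny_i$.
   Context: $\mathrm{I}_{m,1}=\operatorname{diag}(1,\dots,1,-1)$ (size $m+1$); $\mathbb{R}^{m,1}$ is $\mathbb{R}^{m+1}$ with $(x,y)=x^T\mathrm{I}_{m,1}y$; $\mathcal{L}^{2n-1,1}$ is the light-cone $\{(x,x)=0\}$ of $\mathbb{R}^{2n-1,1}$. Fix $t_0$ with $(t_0,t_0)=-1$; $S^{2n-2}$ is the unit sphere of the Euclidean space $t_0^\perp$. An immersion $f:M^n\to S^{2n-2}$ is conformally flat if $e^{2u}\mathrm{I}_f$ is flat for some smooth function $u$. A flat lift of $f$ is a map $F:M\to\mathcal{L}^{2n-1,1}$ with $f+t_0\in\langle F\rangle$ (the line spanned by $F$) whose induced metric is flat. Fundamental forms: $\mathrm{I}_F=(dF,dF)$; $\mathbb{II}_F$ is the normal-bundle valued second fundamental form. For flat normal bundle, the curvature normal $v_i$ of a principal curvature direction $\mathbf{e}_i$ is defined by $A_v\mathbf{e}_i=(v,v_i)\mathbf{e}_i$ for all normal $v$, with $A_v$ the tangential part of $-dv$. Let $U=\mathrm{O}(2n-1,1)$, $K=\mathrm{O}(n)\times\mathrm{O}(n-1,1)$ (block diagonal), $J=\mathrm{I}_{n-1,1}$, $\rho=\operatorname{diag}(\mathrm{I}_n,-\mathrm{I}_n)$ with $\mathrm{I}_n$ the $n\times n$ identity, $\tau(g)=\rho g\rho^{-1}$, and $\mathfrak{u}=\mathfrak{k}+\mathfrak{p}$ the decomposition of the Lie algebra of $U$ into $\pm1$-eigenspaces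 of $\tau$, with $\mathfrak{p}=\left\{\begin{pmatrix}0&\eta^TJ\\ -\eta&0\end{pmatrix}:\eta\in\mathfrak{gl}(n)\right\}$. Let $a_i=\begin{pmatrix}0&e_{ii}J\\ -e_{ii}&0\end{pmatrix}$, $1\le i\le n$, with $e_{ii}$ elementary $n\times n$ matrices, and $\mathfrak{a}$ their span, a maximal abelian subalgebra of $\mathfrak{p}$; $\perp$ is with respect to the Killing form. The $U/K$-system defined by $\mathfrak{a}$, for $\Xi:\mathbb{R}^n\to\mathfrak{a}^\perp\cap\mathfrak{p}$, is $$[a_i,\Xi_{x_j}]-[a_j,\Xi_{x_i}]-[[a_i,\Xi],[a_j,\Xi]]=0,\quad i\ne j,$$ equivalently flatness of $\theta_\lambda$ for all $\lambda\in\mathbb{C}$. An extended flat frame is a solution $\Phi_\lambda:\mathbb{R}^n\times\mathbb{C}\to\mathrm{O}(2n-1,1,\mathbb{C})$ of $\Phi_\lambda^{-1}d\Phi_\lambda=\theta_\lambda$, with $\overline{\Phi_\lambda}=\Phi_{\bar\lambda}$ and $\tau\Phi_\lambda=\Phi_{-\lambda}$. A diffeomorphism $\phi$ between $n$-immersions with flat normal bundle is a Combescure transform if it maps principal directions to principal directions and corresponding directions are parallel; a Combescure transform is a Christoffel transform if it is orientation reversing.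
   Formalization: The printed formulas for II and v_i are false for i<n; they are corrected to II = -sum (u_i,u_i) q_i dx_i^2 u_i and v_i = -(u_i,u_i) q_i^{-1} u_i (unchanged for i=n). ''Locally'' is read as the open set where all q_i are nonzero. *)

(* Defs.v *)
From HB Require Import structures.
From mathcomp Require Import all_boot all_order all_algebra.
From mathcomp Require Import complex.
From mathcomp Require Import all_classical all_reals all_analysis.

Set Implicit Arguments.
Unset Strict Implicit.
Unset Printing Implicit Defensive.

Import Order.TTheory GRing.Theory Num.Theory.
Import numFieldNormedType.Exports.

Local Open Scope classical_set_scope.
Local Open Scope complex_scope.
Local Open Scope ring_scope.

(* I_{m-1,1}; the index counts from 0, so the last one satisfies i.+1 == m. *)
Definition lorentz (K : pzRingType) (m : nat) : 'M[K]_m :=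
  \matrix_(i, j) (if i == j then (if i.+1 == m then -1 else 1) else 0).

Definition ip (R : pzRingType) (m : nat) (x y : 'cV[R]_m) : R :=
  (x^T *m lorentz R m *m y) 0 0.

Definition lie (K : pzRingType) (m : nat) (X Y : 'M[K]_m) : 'M[K]_m :=
  X *m Y - Y *m X.

Definition rho (K : pzRingType) (n : nat) : 'M[K]_(n + n) :=
  block_mx 1%:M 0 0 (- 1%:M).

Definition tau (K : comUnitRingType) (n : nat) (g : 'M[K]_(n + n)) :=
  rho K n *m g *m invmx (rho K n).

Definition in_O (K : pzRingType) (m : nat) (g : 'M[K]_m) : Prop :=
  g^T *m lorentz K m *m g = lorentz K m.

Definition o_eqn (K : fieldType) (m : nat) (X : 'M[K]_m) : 'M[K]_m :=
  X^T *m lorentz K m + lorentz K m *m X.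

Fact o_eqn_is_linear (K : fieldType) (m : nat) : linear (@o_eqn K m).
Proof.
move=> a X Y; rewrite /o_eqn linearP mulmxDl mulmxDr -scalemxAl -scalemxAr.
by rewrite scalerDr addrACA.
Qed.

HB.instance Definition _ (K : fieldType) (m : nat) :=
  GRing.isLinear.Build K 'M[K]_m 'M[K]_m *:%R (@o_eqn K m)
    (@o_eqn_is_linear K m).

Definition o_lie (K : fieldType) (m : nat) : {vspace 'M[K]_m} :=
  lker (linfun (@o_eqn K m)).

Lemma mem_o_lie (K : fieldType) (m : nat) (X : 'M[K]_m) :
  (X \in o_lie K m) = (X^T *m lorentz K m + lorentz K m *m X == 0).
Proof. by rewrite memv_ker lfunE. Qed.

(* The trace of ad X \o ad Y acting on the Lie algebra o_lie. *)
Definition killing (K : fieldType) (m : nat) (X Y : 'M[K]_m) : K :=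
  \sum_(i < \dim (o_lie K m))
    coord (vbasis (o_lie K m)) i (lie X (lie Y (vbasis (o_lie K m))`_i)).

Definition p_mx (K : pzRingType) (n : nat) (eta : 'M[K]_n) : 'M[K]_(n + n) :=
  block_mx 0 (eta^T *m lorentz K n) (- eta) 0.

Definition in_p (K : pzRingType) (n : nat) (X : 'M[K]_(n + n)) : Prop :=
  exists eta : 'M[K]_n, X = p_mx eta.

Definition a_mx (K : pzRingType) (n : nat) (i : 'I_n) : 'M[K]_(n + n) :=
  block_mx 0 (delta_mx i i *m lorentz K n) (- delta_mx i i) 0.

Definition a_sub (K : fieldType) (n : nat) : {vspace 'M[K]_(n + n)} :=
  (<<[seq a_mx K i | i <- enum 'I_n]>>)%VS.

Definition in_aperp (K : fieldType) (n : nat) (X : 'M[K]_(n + n)) : Prop :=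
  forall A, A \in a_sub K n -> killing A X = 0.

Definition partial (R : realType) (n : nat) (W : normedModType R)
    (i : 'I_n) (f : 'rV[R]_n -> W) (x : 'rV[R]_n) : W :=
  'D_(delta_mx 0 i) f x.

(* C^oo on U: all iterated partial derivatives are differentiable.  Only
   meaningful for open U. *)
Definition smooth_on (R : realType) (n : nat) (W : normedModType R)
    (U : set 'rV[R]_n) (f : 'rV[R]_n -> W) : Prop :=
  forall (s : seq 'I_n) (x : 'rV[R]_n), U x ->
    differentiable (foldr (fun i g => partial i g) f s) x.

Definition toC (R : realType) (p q : nat) (A : 'M[R]_(p, q)) : 'M[R[i]]_(p, q) :=
  map_mx (fun a : R => a%:C) A.
Definition re_mx (R : realType) (p q : nat) (A : 'M[R[i]]_(p, q)) : 'M[R]_(p, q) :=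
  map_mx (@complex.Re R) A.
Definition im_mx (R : realType) (p q : nat) (A : 'M[R[i]]_(p, q)) : 'M[R]_(p, q) :=
  map_mx (@complex.Im R) A.
Definition conj_mx (R : realType) (p q : nat) (A : 'M[R[i]]_(p, q)) :
  'M[R[i]]_(p, q) := map_mx (@conjc R) A.

(* Complex matrices are not a normed module over R in the library, so the
   derivative of a complex matrix function of real variables is taken on real
   and imaginary parts. *)
Definition partialC (R : realType) (n p q : nat) (i : 'I_n)
    (f : 'rV[R]_n -> 'M[R[i]]_(p, q)) (x : 'rV[R]_n) : 'M[R[i]]_(p, q) :=
  toC (partial i (fun y => re_mx (f y)) x)
  + (0 +i* 1) *: toC (partial i (fun y => im_mx (f y)) x).

Definition smoothC (R : realType) (n p q : nat)
    (f : 'rV[R]_n -> 'M[R[i]]_(p, q)) : Prop :=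
  smooth_on setT (fun y => re_mx (f y)) /\ smooth_on setT (fun y => im_mx (f y)).

Definition UK_system (R : realType) (n : nat)
    (Xi : 'rV[R]_n -> 'M[R]_(n + n)) : Prop :=
  [/\ smooth_on setT Xi,
      forall x, in_aperp (Xi x) /\ in_p (Xi x)
    & forall (x : 'rV[R]_n) (i j : 'I_n), i != j ->
        lie (a_mx R i) (partial j Xi x) - lie (a_mx R j) (partial i Xi x)
        - lie (lie (a_mx R i) (Xi x)) (lie (a_mx R j) (Xi x)) = 0].

(* The dx_i component of theta_lambda. *)
Definition theta (R : realType) (n : nat) (Xi : 'rV[R]_n -> 'M[R]_(n + n))
    (lam : R[i]) (i : 'I_n) (x : 'rV[R]_n) : 'M[R[i]]_(n + n) :=
  lam *: toC (a_mx R i) + toC (lie (a_mx R i) (Xi x)).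

Definition extended_flat_frame (R : realType) (n : nat)
    (Xi : 'rV[R]_n -> 'M[R]_(n + n))
    (Phi : R[i] -> 'rV[R]_n -> 'M[R[i]]_(n + n)) : Prop :=
  [/\ forall lam, smoothC (Phi lam),
      forall lam x, in_O (Phi lam x),
      forall lam i x,
        invmx (Phi lam x) *m partialC i (Phi lam) x = theta Xi lam i x,
      forall lam x, conj_mx (Phi lam x) = Phi (conjc lam) x
    & forall lam x, tau (Phi lam x) = Phi (- lam) x].

Definition riemannian (R : realType) (n : nat) (U : set 'rV[R]_n)
    (g : 'rV[R]_n -> 'M[R]_n) : Prop :=
  smooth_on U g /\
  forall x, U x -> (g x)^T = g x /\
    forall X : 'rV[R]_n, X != 0 -> 0 < (X *m g x *m X^T) 0 0.

(* Gamma^k_{ij} *)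
Definition christoffel_symbol (R : realType) (n : nat)
    (g : 'rV[R]_n -> 'M[R]_n) (k i j : 'I_n) (x : 'rV[R]_n) : R :=
  2^-1 * \sum_(l < n) (invmx (g x)) k l *
    ((partial i g x) j l + (partial j g x) i l - (partial l g x) i j).

(* The d_l component of R(d_i, d_j) d_k. *)
Definition riemann_tensor (R : realType) (n : nat)
    (g : 'rV[R]_n -> 'M[R]_n) (l i j k : 'I_n) (x : 'rV[R]_n) : R :=
  let G := christoffel_symbol g in
  partial i (G l j k) x - partial j (G l i k) x
  + \sum_(m < n) (G l i m x * G m j k x - G l j m x * G m i k x).

Definition flat_metric (R : realType) (n : nat) (U : set 'rV[R]_n)
    (g : 'rV[R]_n -> 'M[R]_n) : Prop :=
  riemannian U g /\
  forall x, U x -> forall l i j k, riemann_tensor g l i j k x = 0.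

Definition immersive_at (R : realType) (n N : nat)
    (F : 'rV[R]_n -> 'cV[R]_N) (x : 'rV[R]_n) : Prop :=
  differentiable F x /\ injective ('d F x).

Definition immersion (R : realType) (n N : nat) (U : set 'rV[R]_n)
    (F : 'rV[R]_n -> 'cV[R]_N) : Prop :=
  smooth_on U F /\ forall x, U x -> immersive_at F x.

Definition first_ff (R : realType) (n N : nat) (F : 'rV[R]_n -> 'cV[R]_N)
    (x : 'rV[R]_n) : 'M[R]_n :=
  \matrix_(i, j) ip (partial i F x) (partial j F x).

(* Orthogonal projection to the tangent space; meaningful where first_ff F x is
   invertible. *)
Definition tangent_part (R : realType) (n N : nat) (F : 'rV[R]_n -> 'cV[R]_N)
    (x : 'rV[R]_n) (w : 'cV[R]_N) : 'cV[R]_N :=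
  \sum_(i < n) \sum_(j < n)
    ((invmx (first_ff F x)) i j * ip w (partial j F x)) *: partial i F x.

Definition normal_part (R : realType) (n N : nat) (F : 'rV[R]_n -> 'cV[R]_N)
    (x : 'rV[R]_n) (w : 'cV[R]_N) : 'cV[R]_N :=
  w - tangent_part F x w.

Definition second_ff (R : realType) (n N : nat) (F : 'rV[R]_n -> 'cV[R]_N)
    (x : 'rV[R]_n) (i j : 'I_n) : 'cV[R]_N :=
  normal_part F x (partial i (partial j F) x).

Definition is_normal (R : realType) (n N : nat) (F : 'rV[R]_n -> 'cV[R]_N)
    (x : 'rV[R]_n) (w : 'cV[R]_N) : Prop :=
  forall i : 'I_n, ip w (partial i F x) = 0.

Definition normal_field (R : realType) (n N : nat) (O : set 'rV[R]_n)
    (F v : 'rV[R]_n -> 'cV[R]_N) : Prop :=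
  smooth_on O v /\ forall y, O y -> is_normal F y (v y).

Definition normal_connection (R : realType) (n N : nat)
    (F : 'rV[R]_n -> 'cV[R]_N) (i : 'I_n) (v : 'rV[R]_n -> 'cV[R]_N)
    (x : 'rV[R]_n) : 'cV[R]_N :=
  normal_part F x (partial i v x).

(* The coordinate fields commute, so the curvature of the normal connection is
   the commutator of the coordinate covariant derivatives. *)
Definition flat_normal_bundle (R : realType) (n N : nat) (U : set 'rV[R]_n)
    (F : 'rV[R]_n -> 'cV[R]_N) : Prop :=
  forall (O : set 'rV[R]_n) (v : 'rV[R]_n -> 'cV[R]_N),
    open O -> O `<=` U -> normal_field O F v ->
    forall x, O x -> forall i j : 'I_n,
      normal_connection F i (normal_connection F j v) x
      = normal_connection F j (normal_connection F i v) x.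

(* E is a non-zero tangent vector at F x with A_v E = (v, w) E for all normal
   v, where A_v ('d F x X) is the tangential part of - 'd v x X for a local
   normal field v. *)
Definition curvature_normal (R : realType) (n N : nat)
    (F : 'rV[R]_n -> 'cV[R]_N) (x : 'rV[R]_n) (E w : 'cV[R]_N) : Prop :=
  [/\ E != 0,
      exists X : 'rV[R]_n, 'd F x X = E,
      is_normal F x w
    & forall (O : set 'rV[R]_n) (v : 'rV[R]_n -> 'cV[R]_N),
        open O -> O x -> normal_field O F v ->
        forall X : 'rV[R]_n, 'd F x X = E ->
          tangent_part F x (- 'd v x X) = ip (v x) w *: E].

Definition principal_direction (R : realType) (n N : nat)
    (F : 'rV[R]_n -> 'cV[R]_N) (x : 'rV[R]_n) (E : 'cV[R]_N) : Prop :=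
  exists w, curvature_normal F x E w.

Definition diffeomorphism (R : realType) (n : nat) (U V : set 'rV[R]_n)
    (phi : 'rV[R]_n -> 'rV[R]_n) : Prop :=
  exists psi : 'rV[R]_n -> 'rV[R]_n,
    [/\ smooth_on U phi, smooth_on V psi,
        forall x, U x -> V (phi x) /\ psi (phi x) = x
      & forall y, V y -> U (psi y) /\ phi (psi y) = y].

(* The immersed manifolds are (U, F) and (V, G); phi relates parameters, so the
   map between the immersed manifolds is F x |-> G (phi x). *)
Definition combescure_transform (R : realType) (n N : nat)
    (U : set 'rV[R]_n) (F : 'rV[R]_n -> 'cV[R]_N)
    (V : set 'rV[R]_n) (G : 'rV[R]_n -> 'cV[R]_N)
    (phi : 'rV[R]_n -> 'rV[R]_n) : Prop :=
  [/\ [/\ immersion U F, riemannian U (first_ff F) & flat_normal_bundle U F],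
      [/\ immersion V G, riemannian V (first_ff G) & flat_normal_bundle V G],
      diffeomorphism U V phi
    & forall (x X : 'rV[R]_n), U x ->
        principal_direction F x ('d F x X) ->
        principal_direction G (phi x) ('d G (phi x) ('d phi x X)) /\
        exists k : R, 'd G (phi x) ('d phi x X) = k *: 'd F x X].

(* Corresponding tangent spaces of a Combescure transform are the same linear
   subspace, so the differential is an endomorphism L of the tangent space;
   orientation reversing means that its determinant is negative. *)
Definition orientation_reversing (R : realType) (n N : nat)
    (U : set 'rV[R]_n) (F G : 'rV[R]_n -> 'cV[R]_N)
    (phi : 'rV[R]_n -> 'rV[R]_n) : Prop :=
  forall x, U x -> exists L : 'M[R]_n,
    (forall X : 'rV[R]_n, 'd G (phi x) ('d phi x X) = 'd F x (X *m L))
    /\ \det L < 0.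

Definition christoffel_transform (R : realType) (n N : nat)
    (U : set 'rV[R]_n) (F : 'rV[R]_n -> 'cV[R]_N)
    (V : set 'rV[R]_n) (G : 'rV[R]_n -> 'cV[R]_N)
    (phi : 'rV[R]_n -> 'rV[R]_n) : Prop :=
  combescure_transform U F V G phi /\ orientation_reversing U F G phi.

Definition sphere (R : realType) (N : nat) (t0 : 'cV[R]_N) : set 'cV[R]_N :=
  [set y | ip y t0 = 0 /\ ip y y = 1].

Definition conformally_flat (R : realType) (n N : nat) (U : set 'rV[R]_n)
    (f : 'rV[R]_n -> 'cV[R]_N) : Prop :=
  exists u : 'rV[R]_n -> R, smooth_on U u /\
    flat_metric U (fun x => expR (2 * u x) *: first_ff f x).

Definition conformally_flat_immersion (R : realType) (n N : nat)
    (t0 : 'cV[R]_N) (U : set 'rV[R]_n) (f : 'rV[R]_n -> 'cV[R]_N) : Prop :=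
  [/\ immersion U f, forall x, U x -> sphere t0 (f x) & conformally_flat U f].

Definition flat_lift (R : realType) (n N : nat) (t0 : 'cV[R]_N)
    (U : set 'rV[R]_n) (f F : 'rV[R]_n -> 'cV[R]_N) : Prop :=
  [/\ smooth_on U F,
      forall x, U x -> ip (F x) (F x) = 0,
      forall x, U x -> exists k : R, f x + t0 = k *: F x
    & flat_metric U (first_ff F)].

(* For an extended flat frame, P1 is Phi_1 and g2 the lower right block of
   Phi_0, both as real matrices. *)
Definition qvec (R : realType) (n : nat) (g2 : 'rV[R]_n -> 'M[R]_n)
    (c : 'cV[R]_n) (x : 'rV[R]_n) : 'cV[R]_n := invmx (g2 x) *m c.

Definition Fmap (R : realType) (n : nat) (P1 : 'rV[R]_n -> 'M[R]_(n + n))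
    (g2 : 'rV[R]_n -> 'M[R]_n) (c : 'cV[R]_n) (x : 'rV[R]_n) : 'cV[R]_(n + n) :=
  P1 x *m col_mx 0 (qvec g2 c x).

Definition regular_set (R : realType) (n : nat) (g2 : 'rV[R]_n -> 'M[R]_n)
    (c : 'cV[R]_n) : set 'rV[R]_n :=
  [set x | forall i : 'I_n, qvec g2 c x i 0 != 0].

Definition hprod (R : realType) (n : nat) (y : 'cV[R]_n) : R :=
  \prod_(i < n) y i 0.

(* Main.v *)
Require Import Defs.
From mathcomp Require Import all_boot all_order all_algebra.
From mathcomp Require Import complex.
From mathcomp Require Import all_classical all_reals all_analysis.
From mathcomp Require Import ring lra.

(** Write e_1, ..., e_n, u_1, ..., u_n for the columns of P = Phi_1, and sgn i
    for the square of u_i. Since P^-1 d_i P = a_i + [a_i, Xi], while Phi_0 =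
    diag(g1, g2) satisfies Phi_0^-1 d_i Phi_0 = [a_i, Xi], the product P Phi_0^-1
    has the derivative P a_i Phi_0^-1, in which only a_i remains. Hence the last
    n columns M of P Phi_0^-1 ([normal_frame]) have derivatives in the span of
    e_1, ..., e_n ([partial_normal_frame]). With q = g2^-1 c, the lift is F = M c
    and d_i F = sgn i q_i e_i: where no q_i vanishes, F is an immersion with
    induced metric the sum of the q_i^2 dx_i^2, and the columns of M form a
    parallel frame of its normal bundle.

    Every normal field is therefore M w for a smooth w, with d_i (M w) equal to a
    multiple of e_i plus the normal part M d_i w ([partial_normal_field]). The
    symmetry of the second derivatives of w makes the normal bundle flat, and the
    tangential parts give the curvature normals. As the curvature normals of
    e_1, ..., e_n are linearly independent, the e_i span the only principal
    directions ([principal_direction_lift]).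

    The diagonal blocks of [a_i, Xi] are both built from one matrix eta, whose
    off-diagonal entries give the derivatives of g1 as well as those of q. As a
    result, the columns E_j of E = g1 diag(sgn j q_j) satisfy d_i E_j = d_j E_i
    ([coframe_closed]). As the induced metric is E^T E, the Christoffel symbols
    are the entries of the matrices E^-1 d_i E, and the curvature vanishes by the
    symmetry of second derivatives again ([riemann_tensor_coframe]).

    A non-zero null vector is never orthogonal to a time-like one
    ([null_orthogonal_timelike]), so F can be rescaled to f + t0 with f in the
    sphere; the rescaling changes the induced metric by a conformal factor.

    Finally, for two null vectors b and c, the map from F_c to F_b sends
    sgn i q_i e_i to the same expression with the q_i of b. It acts on the common
    tangent space as a diagonal matrix whose determinant is
    h(g2^-1 b) / h(g2^-1 c). *)

Import Order.TTheory GRing.Theory Num.Theory.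
Import numFieldNormedType.Exports.
Local Open Scope classical_set_scope.
Local Open Scope ring_scope.

Set Implicit Arguments.
Unset Strict Implicit.
Unset Printing Implicit Defensive.

(** * Derivatives: locality and symmetry *)

Section Locality.
Context {R : realType} {V W : normedModType R}.

Lemma near_translate (P : V -> Prop) (x : V) :
  (\forall y \near x, P y) -> \forall h \near (0 : V), P (h + x).
Proof. by rewrite (near_shift 0 x) subr0. Qed.

Lemma near_eq_diff (f g : V -> W) (x : V) :
  (\forall y \near x, f y = g y) -> differentiable f x ->
  differentiable g x /\ 'd g x = 'd f x :> (V -> W).
Proof.
move=> fg df.
have H : g \o shift x = cst (g x) + 'd f x +o_ 0 id.
  have /eqaddoP Hf := diff_locally df.
  apply/eqaddoP => e e0; have {}Hf := Hf e e0.
  have fg0 := near_translate fg.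
  have gx := nbhs_singleton fg.
  near=> h; rewrite -gx.
  have eh : f (h + x) = g (h + x) by near: h.
  suff : `|g (h + x) - (f x + 'd f x h)| <= e * `|h| by [].
  rewrite -eh; suff : `|(f \o shift x - (cst (f x) + 'd f x)) h| <= e * `|h| by [].
  by near: h.
have dfc := diff_continuous df.
have E := diff_unique dfc H.
by split; [apply/diff_locallyP; rewrite E; split; [exact: dfc|exact: H]|exact: E].
Unshelve. all: by end_near. Qed.

End Locality.

Section Schwarz.
Context {R : realType} {V : normedModType R}.

(** The second difference of [f] along [a] and [b] is [t ^+ 2] times the iterated
    derivative, up to a small error. The mean value theorem is applied along [a]
    only; as the left-hand expression is symmetric in [a] and [b], comparing the
    two orders gives the symmetry of second derivatives. *)
Lemma second_difference (f : V -> R) (x a b : V) :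
  (\forall y \near x, differentiable f y) ->
  differentiable ('D_a f) x ->
  forall e : R, 0 < e -> exists2 d : R, 0 < d & forall t, 0 < t < d ->
    `|f (t *: a + t *: b + x) - f (t *: a + x) - f (t *: b + x) + f x
      - t ^+ 2 * 'D_b ('D_a f) x| <= e * t ^+ 2.
Proof.
move=> fd dg e e0.
set g := 'D_a f in dg *.
(* The two points at which the derivative is expanded below have distances to x
   adding up to at most t * (2 * `|a| + `|b|). *)
set m := 2 * `|a| + `|b| + 1.
have m0 : 0 < m by rewrite /m; have := normr_ge0 a; have := normr_ge0 b; lra.
have e'0 : 0 < e / m by exact: divr_gt0.
have /eqaddoP/(_ _ e'0) Hg := diff_locally dg.
have fd0 := near_translate fd.
have [d /= d0 Hd] : exists2 d : R, 0 < d & forall h : V, `|h| < d ->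
    `|g (h + x) - (g x + 'd g x h)| <= e / m * `|h| /\ differentiable f (h + x).
  have Hgf : \forall h \near (0 : V),
      `|g (h + x) - (g x + 'd g x h)| <= e / m * `|h| /\ differentiable f (h + x).
    by apply: filterI fd0; exact: Hg.
  move/nbhs_ballP : Hgf => [d d0 Hd].
  exists d => // h hd; apply: Hd; rewrite -ball_normE /= sub0r normrN; exact: hd.
exists (d / m); first exact: divr_gt0.
move=> t /andP[t0 td].
have tmd : t * m < d by rewrite -ltr_pdivlMr.
have na := normr_ge0 a; have nb := normr_ge0 b.
have small1 c : c \in `[0, t] -> `|c *: a + t *: b| <= t * (`|a| + `|b|).
  rewrite in_itv /= => /andP[c0 ct].
  apply: le_trans (ler_normD _ _) _; rewrite !normrZ (ger0_norm c0) (gtr0_norm t0).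
  by rewrite mulrDr lerD2r ler_wpM2r.
have small2 c : c \in `[0, t] -> `|c *: a| <= t * `|a|.
  by rewrite in_itv /= => /andP[c0 ct]; rewrite normrZ (ger0_norm c0) ler_wpM2r.
have lt1 : t * (`|a| + `|b|) < d.
  by apply: le_lt_trans tmd; rewrite ler_pM2l // /m; lra.
have lt2 : t * `|a| < d.
  by apply: le_lt_trans tmd; rewrite ler_pM2l // /m; lra.
have line (y : V) (s : R) : differentiable f (s *: a + y) ->
    is_derive s (1 : R) (fun s => f (s *: a + y)) (g (s *: a + y)).
  move=> dfy.
  have dl : is_diff s (fun r : R => r *: a + y) (fun r : R => r *: a + 0).
    exact: (is_diffD (is_diff_scalel s a) (is_diff_cst y s)).
  have dc : differentiable (f \o (fun r : R => r *: a + y)) s.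
    apply: differentiable_comp; [exact: (@ex_diff _ _ _ _ _ _ _ dl)|exact: dfy].
  apply: DeriveDef; first exact/derivable1_diffP.
  rewrite (deriveE _ dc) (diff_comp (@ex_diff _ _ _ _ _ _ _ dl) dfy) /=.
  by rewrite (@diff_val _ _ _ _ _ _ _ dl) scale1r addr0 -(deriveE _ dfy).
pose phi (s : R) := f (s *: a + (t *: b + x)) - f (s *: a + x).
have dphi s : s \in `[0, t] ->
    is_derive s (1 : R) phi (g (s *: a + (t *: b + x)) - g (s *: a + x)).
  move=> st; apply: is_deriveB; apply: line.
    rewrite addrA; apply: (Hd _ _).2; exact: le_lt_trans (small1 _ st) lt1.
  by apply: (Hd _ _).2; exact: le_lt_trans (small2 _ st) lt2.
have cphi : {within `[0, t], continuous phi}.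
  apply: derivable_within_continuous => s st.
  exact: (@ex_derive _ _ _ _ _ _ _ (dphi s st)).
have [c /subset_itv_oo_cc ct] := MVT t0 (fun s st => dphi s (subset_itv_oo_cc st)) cphi.
rewrite subr0 /phi !scale0r !add0r => E.
have -> : f (t *: a + t *: b + x) - f (t *: a + x) - f (t *: b + x) + f x =
   (g (c *: a + t *: b + x) - g (c *: a + x)) * t.
  by rewrite -[t *: a + t *: b + x]addrA -[c *: a + _ + x]addrA -E; ring.
have [H1 _] := Hd _ (le_lt_trans (small1 _ ct) lt1).
have [H2 _] := Hd _ (le_lt_trans (small2 _ ct) lt2).
have Dd : 'd g x (c *: a + t *: b) = 'd g x (c *: a) + t * 'd g x b.
  by rewrite linearD [X in _ + X = _]linearZ.
rewrite (deriveE _ dg); rewrite Dd in H1.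
set G1 := g (_ + x) in H1 *; set G2 := g (c *: a + x) in H2 *.
set D1 := 'd g x (c *: a) in H1 H2; set D2 := 'd g x b in H1 *.
have -> : (G1 - G2) * t - t ^+ 2 * D2 =
   t * ((G1 - (g x + (D1 + t * D2))) - (G2 - (g x + D1))) by ring.
rewrite normrM (gtr0_norm t0).
have H3 : `|(G1 - (g x + (D1 + t * D2))) - (G2 - (g x + D1))|
   <= e / m * (t * (`|a| + `|b|)) + e / m * (t * `|a|).
  apply: le_trans (ler_normB _ _) _; apply: lerD.
    by apply: le_trans H1 _; rewrite ler_pM2l ?small1.
  by apply: le_trans H2 _; rewrite ler_pM2l ?small2.
have H4 : e / m * (t * (`|a| + `|b|)) + e / m * (t * `|a|) <= e * t.
  have -> : e * t = e / m * (t * m) by field; rewrite gt_eqF.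
  by rewrite -mulrDr ler_pM2l // -mulrDr ler_pM2l // /m; lra.
have -> : e * t ^+ 2 = t * (e * t) by ring.
by rewrite ler_pM2l //; apply: le_trans H3 H4.
Unshelve. all: by end_near. Qed.

Lemma schwarz (f : V -> R) (x a b : V) :
  (\forall y \near x, differentiable f y) ->
  differentiable ('D_a f) x -> differentiable ('D_b f) x ->
  'D_b ('D_a f) x = 'D_a ('D_b f) x.
Proof.
move=> df da db; apply/eqP; rewrite -subr_eq0 -normr_eq0 eq_le normr_ge0 andbT.
apply/ler_addgt0Pl => e e0; rewrite addr0.
have e20 : 0 < e / 2 by lra.
have [d1 d10 H1] := second_difference b df da e20.
have [d2 d20 H2] := second_difference a df db e20.
pose d := Num.min d1 d2.
have d0 : 0 < d by rewrite lt_min d10.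
have tt : 0 < d / 2 by lra.
have dd : d / 2 < d by lra.
move: dd; rewrite {2}/d lt_min => /andP[t1 t2].
have := H2 (d / 2); rewrite tt t2 => /(_ isT).
have := H1 (d / 2); rewrite tt t1 => /(_ isT).
set t := d / 2 in tt *.
rewrite [t *: b + t *: a]addrC.
set Da := 'D_b _ x; set Db := 'D_a _ x => K1 K2.
have t20 : 0 < t ^+ 2 by exact: exprn_gt0.
rewrite -(ler_pM2r t20) -{1}(gtr0_norm t20) -normrM.
have -> : e * t ^+ 2 = e / 2 * t ^+ 2 + e / 2 * t ^+ 2 by field.
apply: le_trans (lerD K2 K1); apply: le_trans (ler_normB _ _).
rewrite le_eqVlt; apply/orP; left; apply/eqP; congr `|_|; ring.
Qed.

End Schwarz.

(** * Smooth functions *)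

Section SmoothGeneral.
Context {R : realType} {n : nat}.
Implicit Types (W : normedModType R) (U : set 'rV[R]_n).

Lemma smooth_onS W U V (f : 'rV[R]_n -> W) :
  V `<=` U -> smooth_on U f -> smooth_on V f.
Proof. by move=> VU sf s x /VU; exact: sf. Qed.

Lemma smooth_on_diff W U (f : 'rV[R]_n -> W) x :
  smooth_on U f -> U x -> differentiable f x.
Proof. by move=> sf; exact: (sf [::]). Qed.

Lemma smooth_on_partial W U (f : 'rV[R]_n -> W) i :
  smooth_on U f -> smooth_on U (partial i f).
Proof. by move=> sf s x Ux; have := sf (rcons s i) x Ux; rewrite foldr_rcons. Qed.

Lemma partial_eq_on W U (f g : 'rV[R]_n -> W) i : open U ->
  (forall x, U x -> f x = g x) ->
  forall x, U x -> partial i f x = partial i g x.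
Proof.
move=> oU fg x Ux; apply: near_eq_derive.
by apply: filterS (open_nbhs_nbhs (conj oU Ux)) => y; exact: fg.
Qed.

Lemma differentiable_eq_on W U (f g : 'rV[R]_n -> W) x : open U -> U x ->
  (forall x, U x -> f x = g x) -> differentiable f x -> differentiable g x.
Proof.
move=> oU Ux fg df; apply: (near_eq_diff _ df).1.
by apply: filterS (open_nbhs_nbhs (conj oU Ux)) => y; exact: fg.
Qed.

Lemma foldr_partial_eq_on W U (f g : 'rV[R]_n -> W) s : open U ->
  (forall x, U x -> f x = g x) ->
  forall x, U x -> foldr (fun i g => partial i g) f s x
                 = foldr (fun i g => partial i g) g s x.
Proof. by move=> oU fg; elim: s => //= i s IH; exact: partial_eq_on. Qed.

(** A class of functions that are differentiable on [U], and whose partial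
    derivatives agree on [U] with members of the class, consists of smooth
    functions. *)
Lemma smooth_on_coind W U (P : ('rV[R]_n -> W) -> Prop) : open U ->
  (forall f, P f -> (forall x, U x -> differentiable f x) /\
     forall i, exists2 g, P g & forall x, U x -> partial i f x = g x) ->
  forall f, P f -> smooth_on U f.
Proof.
move=> oU HP f Pf s; elim/last_ind: s f Pf => [|s i IH] f Pf x Ux.
  exact: (HP f Pf).1 x Ux.
rewrite foldr_rcons; have [g Pg fg] := (HP f Pf).2 i.
apply: (differentiable_eq_on oU Ux _ (IH g Pg x Ux)) => y Uy.
by apply/esym; exact: (foldr_partial_eq_on s oU fg Uy).
Qed.

Lemma partial_cst W (w : W) i x : partial i (cst w : 'rV[R]_n -> W) x = 0.
Proof. exact: derive_cst. Qed.

Lemma smooth_on_cst W U (w : W) : smooth_on U (cst w : 'rV[R]_n -> W).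
Proof.
move=> s x _.
have [v ->] : exists v, foldr (fun i g => partial i g) (cst w) s = cst v.
  elim: s => [|i s [v /= ->]]; first by exists w.
  by exists 0; apply/funext => y; exact: partial_cst.
exact: differentiable_cst.
Qed.

Lemma smooth_on_id U : smooth_on U (id : 'rV[R]_n -> 'rV[R]_n).
Proof.
move=> s x Ux; elim/last_ind: s => [|s i _].
  exact: (@ex_diff _ _ _ _ _ _ _ (is_diff_id x)).
rewrite foldr_rcons (_ : partial i id = cst (delta_mx 0 i)).
  exact: (@smooth_on_cst _ U (delta_mx 0 i) s x Ux).
by apply/funext => y; exact: derive_id.
Qed.

Lemma diff_partial W (f : 'rV[R]_n -> W) x X : differentiable f x ->
  'd f x X = \sum_(i < n) X 0 i *: partial i f x.
Proof.
move=> df; rewrite {1}[X]row_sum_delta linear_sum; apply: eq_bigr => i _.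
by rewrite linearZ /partial (deriveE _ df).
Qed.

End SmoothGeneral.

Section SmoothScalar.
Context {R : realType} {n : nat}.
Implicit Types (U : set 'rV[R]_n) (f g : 'rV[R]_n -> R).

Lemma partialD f g i x : differentiable f x -> differentiable g x ->
  partial i (fun y => f y + g y) x = partial i f x + partial i g x.
Proof. by move=> df dg; apply: deriveD; exact: diff_derivable. Qed.

Lemma partialM f g i x : differentiable f x -> differentiable g x ->
  partial i (fun y => f y * g y) x = partial i f x * g x + f x * partial i g x.
Proof.
move=> df dg; rewrite [LHS]deriveM; [|exact: diff_derivable..].
by rewrite addrC [g x *: _]mulrC.
Qed.

Lemma partialV f i x : differentiable f x -> f x != 0 ->
  partial i (fun y => (f y)^-1) x = - (partial i f x * ((f x)^-1 * (f x)^-1)).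
Proof.
move=> df f0; rewrite [LHS]deriveV; [|exact: f0|exact: diff_derivable].
by rewrite scaleNr -exprVn expr2 [_ *: _]mulrC.
Qed.

Lemma diff_ln_comp f x : differentiable f x -> 0 < f x ->
  differentiable (fun y => ln (f y)) x /\
  forall i, partial i (fun y => ln (f y)) x = partial i f x * (f x)^-1.
Proof.
move=> df f0; have dl := is_derive1_ln f0.
have dln : differentiable (@ln R) (f x).
  by apply/derivable1_diffP; exact: (@ex_derive _ _ _ _ _ _ _ dl).
have dc : differentiable (@ln R \o f) x by apply: differentiable_comp df dln.
split; first exact: dc.
move=> i; rewrite /partial (deriveE _ df) [LHS](deriveE _ dc) (diff_comp df dln) /=.
rewrite (diff1E dln) derive1E (@derive_val _ _ _ _ _ _ _ dl); exact: erefl.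
Qed.

(** The closure of the smooth functions under the field operations and the
    logarithm. Differentiation maps this class to itself, which yields all the
    closure properties of smooth functions at once. *)
Inductive arith_smooth U : ('rV[R]_n -> R) -> Prop :=
| ArithBase f : smooth_on U f -> arith_smooth U f
| ArithD f g : arith_smooth U f -> arith_smooth U g ->
    arith_smooth U (fun x => f x + g x)
| ArithM f g : arith_smooth U f -> arith_smooth U g ->
    arith_smooth U (fun x => f x * g x)
| ArithN f : arith_smooth U f -> arith_smooth U (fun x => - f x)
| ArithV f : (forall x, U x -> f x != 0) -> arith_smooth U f ->
    arith_smooth U (fun x => (f x)^-1)
| ArithLn f : (forall x, U x -> 0 < f x) -> arith_smooth U f ->
    arith_smooth U (fun x => ln (f x)).

Lemma arith_smooth_on U f : open U -> arith_smooth U f -> smooth_on U f.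
Proof.
move=> oU; move: f; apply: smooth_on_coind => // f; elim => {f}.
- move=> f sf; split=> [x Ux|i]; first exact: smooth_on_diff sf Ux.
  exists (partial i f) => //; constructor; exact: smooth_on_partial.
- move=> f g af [df pf] ag [dg pg]; split=> [x Ux|i].
    by apply: differentiableD; [exact: df|exact: dg].
  have [f' af' ef] := pf i; have [g' ag' eg] := pg i.
  exists (fun x => f' x + g' x); first exact: ArithD.
  by move=> x Ux; rewrite partialD ?ef ?eg //; [exact: df|exact: dg].
- move=> f g af [df pf] ag [dg pg]; split=> [x Ux|i].
    by apply: differentiableM; [exact: df|exact: dg].
  have [f' af' ef] := pf i; have [g' ag' eg] := pg i.
  exists (fun x => f' x * g x + f x * g' x).
    by apply: ArithD; apply: ArithM.
  by move=> x Ux; rewrite partialM ?ef ?eg //; [exact: df|exact: dg].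
- move=> f af [df pf]; split=> [x Ux|i].
    by apply: differentiableN; exact: df.
  have [f' af' ef] := pf i.
  exists (fun x => - f' x); first exact: ArithN.
  move=> x Ux; rewrite -ef //; apply: deriveN; apply: diff_derivable; exact: df.
- move=> f f0 af [df pf]; split=> [x Ux|i].
    by apply: differentiableV; [exact: df|exact: f0].
  have [f' af' ef] := pf i.
  exists (fun x => - (f' x * ((f x)^-1 * (f x)^-1))).
    by apply: ArithN; apply: ArithM => //; apply: ArithM; apply: ArithV.
  move=> x Ux; rewrite -ef //; apply: partialV; [exact: df|exact: f0].
- move=> f f0 af [df pf]; split=> [x Ux|i].
    by apply: (diff_ln_comp (df x Ux) (f0 x Ux)).1.
  have [f' af' ef] := pf i.
  exists (fun x => f' x * (f x)^-1).
    by apply: ArithM => //; apply: ArithV => // x Ux; rewrite gt_eqF // f0.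
  by move=> x Ux; rewrite -ef //; exact: (diff_ln_comp (df x Ux) (f0 x Ux)).2.
Qed.

Lemma smooth_onD U f g : open U -> smooth_on U f -> smooth_on U g ->
  smooth_on U (fun x => f x + g x).
Proof.
by move=> oU sf sg; apply: arith_smooth_on => //; apply: ArithD; apply: ArithBase.
Qed.

Lemma smooth_onM U f g : open U -> smooth_on U f -> smooth_on U g ->
  smooth_on U (fun x => f x * g x).
Proof.
by move=> oU sf sg; apply: arith_smooth_on => //; apply: ArithM; apply: ArithBase.
Qed.

Lemma smooth_onN U f : open U -> smooth_on U f -> smooth_on U (fun x => - f x).
Proof.
by move=> oU sf; apply: arith_smooth_on => //; apply: ArithN; apply: ArithBase.
Qed.

Lemma smooth_onV U f : open U -> (forall x, U x -> f x != 0) ->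
  smooth_on U f -> smooth_on U (fun x => (f x)^-1).
Proof.
by move=> oU f0 sf; apply: arith_smooth_on => //; apply: ArithV => //; apply: ArithBase.
Qed.

Lemma smooth_on_ln U f : open U -> (forall x, U x -> 0 < f x) ->
  smooth_on U f -> smooth_on U (fun x => ln (f x)).
Proof.
by move=> oU f0 sf; apply: arith_smooth_on => //; apply: ArithLn => //; apply: ArithBase.
Qed.

Lemma smooth_on_sum U m (f : 'I_m -> 'rV[R]_n -> R) : open U ->
  (forall k, smooth_on U (f k)) -> smooth_on U (fun x => \sum_(k < m) f k x).
Proof.
move=> oU sf.
have -> : (fun x => \sum_(k < m) f k x) = \sum_(k < m) f k.
  by apply/funext => x; rewrite fct_sumE.
apply: big_ind => // [|g h sg sh]; first exact: smooth_on_cst.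
exact: smooth_onD.
Qed.

Lemma partial_comm U f i j : open U -> smooth_on U f ->
  forall x, U x -> partial i (partial j f) x = partial j (partial i f) x.
Proof.
move=> oU sf x Ux; apply: schwarz.
- apply: filterS (open_nbhs_nbhs (conj oU Ux)) => y; exact: smooth_on_diff sf.
- exact: smooth_on_diff (smooth_on_partial j sf) Ux.
- exact: smooth_on_diff (smooth_on_partial i sf) Ux.
Qed.

End SmoothScalar.

Section SmoothMatrix.
Context {R : realType} {n : nat}.
Implicit Types (U : set 'rV[R]_n).

Lemma differentiable_mxP p q (F : 'rV[R]_n -> 'M[R]_(p, q)) x :
  differentiable F x <-> forall a b, differentiable (fun y => F y a b) x.
Proof.
split=> [dF a b|dF].
  exact: (differentiable_comp dF (differentiable_coord (F x) a b)).
have -> : F = \sum_(a < p) \sum_(b < q) (fun y => F y a b *: delta_mx a b).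
  apply/funext => y; rewrite {1}[F y]matrix_sum_delta fct_sumE.
  by apply: eq_bigr => a _; rewrite fct_sumE.
apply: differentiable_sum => a; apply: differentiable_sum => b.
exact: differentiableZl.
Qed.

Lemma partial_mxE p q (F : 'rV[R]_n -> 'M[R]_(p, q)) i x a b :
  differentiable F x -> partial i F x a b = partial i (fun y => F y a b) x.
Proof.
by move=> dF; rewrite /partial derive_mx ?mxE //; exact: diff_derivable.
Qed.

Lemma smooth_on_mxP p q U (F : 'rV[R]_n -> 'M[R]_(p, q)) : open U ->
  smooth_on U F <-> forall a b, smooth_on U (fun x => F x a b).
Proof.
move=> oU; split=> [sF a b|sF].
  pose P (f : 'rV[R]_n -> R) :=
    exists2 G : 'rV[R]_n -> 'M[R]_(p, q), smooth_on U G &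
      forall x, U x -> G x a b = f x.
  apply: (@smooth_on_coind _ _ _ U P oU) => [f [G sG Gf]|]; last by exists F.
  split=> [x Ux|i].
    apply: (differentiable_eq_on oU Ux Gf).
    exact: ((differentiable_mxP G x).1 (smooth_on_diff sG Ux) a b).
  exists (fun x => partial i G x a b).
    by exists (partial i G) => //; exact: smooth_on_partial.
  move=> x Ux; rewrite partial_mxE; last exact: smooth_on_diff sG Ux.
  by apply/esym; exact: partial_eq_on Gf _ Ux.
pose P (F : 'rV[R]_n -> 'M[R]_(p, q)) :=
  forall a b, smooth_on U (fun x => F x a b).
apply: (@smooth_on_coind _ _ _ U P oU) => // {sF}F sF; split=> [x Ux|i].
  by apply/differentiable_mxP => a b; exact: smooth_on_diff (sF a b) Ux.
exists (fun x => \matrix_(a, b) partial i (fun y => F y a b) x).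
  move=> a b.
  rewrite (_ : (fun x => _) = partial i (fun y => F y a b)); last first.
    by apply/funext => x; rewrite mxE.
  exact: smooth_on_partial.
move=> x Ux; apply/matrixP => a b; rewrite mxE partial_mxE //.
by apply/differentiable_mxP => c d; exact: smooth_on_diff (sF c d) Ux.
Qed.

Lemma smooth_on_entry p q U (F : 'rV[R]_n -> 'M[R]_(p, q)) a b : open U ->
  smooth_on U F -> smooth_on U (fun x => F x a b).
Proof. by move=> oU /(smooth_on_mxP _ oU). Qed.

Lemma differentiable_mulmx p q r (A : 'rV[R]_n -> 'M[R]_(p, q))
    (B : 'rV[R]_n -> 'M[R]_(q, r)) x :
  differentiable A x -> differentiable B x ->
  differentiable (fun y => A y *m B y) x.
Proof.
move=> /differentiable_mxP dA /differentiable_mxP dB; apply/differentiable_mxP => a b.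
rewrite (_ : (fun y => _) = \sum_(k < q) (fun y => A y a k * B y k b)); last first.
  by apply/funext => y; rewrite mxE fct_sumE.
by apply: differentiable_sum => k; apply: differentiableM.
Qed.

Lemma partial_mulmx p q r (A : 'rV[R]_n -> 'M[R]_(p, q))
    (B : 'rV[R]_n -> 'M[R]_(q, r)) i x :
  differentiable A x -> differentiable B x ->
  partial i (fun y => A y *m B y) x =
  partial i A x *m B x + A x *m partial i B x.
Proof.
move=> dA dB; apply/matrixP => a b.
rewrite partial_mxE; last exact: differentiable_mulmx.
rewrite (_ : (fun y => _) = \sum_(k < q) (fun y => A y a k * B y k b)); last first.
  by apply/funext => y; rewrite mxE fct_sumE.
move/differentiable_mxP : (dA) => dA'; move/differentiable_mxP : (dB) => dB'.
rewrite /partial derive_sum => [|k]; last first.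
  by apply: diff_derivable; apply: differentiableM.
rewrite !mxE -big_split; apply: eq_bigr => k _ /=.
by rewrite !partial_mxE // -partialM.
Qed.

Lemma smooth_on_mulmx p q r U (A : 'rV[R]_n -> 'M[R]_(p, q))
    (B : 'rV[R]_n -> 'M[R]_(q, r)) : open U ->
  smooth_on U A -> smooth_on U B -> smooth_on U (fun y => A y *m B y).
Proof.
move=> oU sA sB; apply/(smooth_on_mxP _ oU) => a b.
rewrite (_ : (fun y => _) = (fun y => \sum_(k < q) A y a k * B y k b)); last first.
  by apply/funext => y; rewrite mxE.
by apply: smooth_on_sum => // k; apply: smooth_onM => //; exact: smooth_on_entry.
Qed.

Lemma differentiable_trmx p q (F : 'rV[R]_n -> 'M[R]_(p, q)) x :
  differentiable F x -> differentiable (fun y => (F y)^T) x.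
Proof.
move=> /differentiable_mxP dF; apply/differentiable_mxP => a b.
rewrite (_ : (fun y => _) = (fun y => F y b a)) //.
by apply/funext => y; rewrite mxE.
Qed.

Lemma partial_trmx p q (F : 'rV[R]_n -> 'M[R]_(p, q)) i x :
  differentiable F x -> partial i (fun y => (F y)^T) x = (partial i F x)^T.
Proof.
move=> dF; apply/matrixP => a b; rewrite mxE (partial_mxE i b a dF).
rewrite (partial_mxE i a b (differentiable_trmx dF)).
by congr (partial i _ x); apply/funext => y; rewrite mxE.
Qed.

Lemma smooth_on_trmx p q U (F : 'rV[R]_n -> 'M[R]_(p, q)) : open U ->
  smooth_on U F -> smooth_on U (fun y => (F y)^T).
Proof.
move=> oU sF; apply/(smooth_on_mxP _ oU) => a b.
rewrite (_ : (fun y => _) = (fun y => F y b a)); first exact: smooth_on_entry.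
by apply/funext => y; rewrite mxE.
Qed.

Lemma partial_scale p r (k : 'rV[R]_n -> R) (F : 'rV[R]_n -> 'M[R]_(p, r)) i x :
  differentiable k x -> differentiable F x ->
  differentiable (fun y => k y *: F y) x /\
  partial i (fun y => k y *: F y) x = partial i k x *: F x + k x *: partial i F x.
Proof.
move=> dk dF; have dF' := (differentiable_mxP F x).1 dF.
have dkF : differentiable (fun y => k y *: F y) x.
  apply/differentiable_mxP => a b.
  rewrite (_ : (fun y => _) = (fun y => k y * F y a b)).
    by apply: differentiableM => //; exact: dF'.
  by apply/funext => y; rewrite mxE.
split=> //; apply/matrixP => a b; rewrite (partial_mxE i a b dkF).
rewrite (_ : (fun y => _) = (fun y => k y * F y a b)); last first.
  by apply/funext => y; rewrite mxE.
rewrite (partialM i dk (dF' a b)) -(partial_mxE i a b dF).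
by move: (partial i F x) (partial i k x) => A B; rewrite !mxE.
Qed.

Lemma partial_comm_mx p q U (F : 'rV[R]_n -> 'M[R]_(p, q)) i j : open U ->
  smooth_on U F ->
  forall x, U x -> partial i (partial j F) x = partial j (partial i F) x.
Proof.
move=> oU sF x Ux; apply/matrixP => a b.
have sP k : smooth_on U (partial k F) by exact: smooth_on_partial.
have dP k : differentiable (partial k F) x.
  exact: smooth_on_diff (sP k) Ux.
have E k y : U y -> partial k F y a b = partial k (fun y => F y a b) y.
  by move=> Uy; apply: partial_mxE; exact: smooth_on_diff sF Uy.
have E2 k l : partial k (partial l F) x a b
    = partial k (partial l (fun y => F y a b)) x.
  apply: etrans (partial_mxE k a b (dP l)) _.
  exact: partial_eq_on oU (E l) _ Ux.
apply: etrans (E2 i j) _; apply: etrans _ (esym (E2 j i)).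
apply: (partial_comm i j oU _ Ux).
exact: smooth_on_entry.
Qed.

End SmoothMatrix.

(** * Flatness of metrics with a closed coframe *)

Section Flatness.
Context {R : realType} {n : nat}.
Implicit Types (U : set 'rV[R]_n).

Lemma partial_left_inverse p U (H E : 'rV[R]_n -> 'M[R]_p) i x : open U ->
  (forall y, U y -> H y *m E y = 1%:M) -> U x ->
  differentiable H x -> differentiable E x ->
  partial i H x = - (H x *m partial i E x *m H x).
Proof.
move=> oU HE Ux dH dE.
have := partial_mulmx i dH dE.
rewrite (partial_eq_on i (g := cst 1%:M) oU HE Ux) partial_cst.
move/eqP; rewrite eq_sym addr_eq0 => /eqP /(congr1 (mulmx^~ (H x))) /=.
by rewrite mulNmx -[X in X = _]mulmxA (mulmx1C (HE _ Ux)) mulmx1.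
Qed.

Variables (U : set 'rV[R]_n) (g E H : 'rV[R]_n -> 'M[R]_n).
Hypothesis oU : open U.
Hypothesis sE : smooth_on U E.
Hypothesis sH : smooth_on U H.
Hypothesis HE : forall x, U x -> H x *m E x = 1%:M.
Hypothesis gE : forall x, U x -> g x = (E x)^T *m E x.
Hypothesis Esym : forall x, U x -> forall i j a,
  partial i E x a j = partial j E x a i.

(** The connection matrices of a metric [E^T E] with a closed coframe [E], whose
    inverse is [H], are [E^-1 d_i E]. *)
Lemma christoffel_coframe k i j x : U x ->
  christoffel_symbol g k i j x = (H x *m partial i E x) k j.
Proof.
move=> Ux; have dE := smooth_on_diff sE Ux.
have EH := mulmx1C (HE Ux).
have invg : invmx (g x) = H x *m (H x)^T.
  rewrite gE //; set A := _ *m E x.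
  have HA : H x *m (H x)^T *m A = 1%:M.
    by rewrite /A mulmxA -(mulmxA (H x)) -trmx_mul EH trmx1 mulmx1 HE.
  have [_ uA] := mulmx1_unit HA.
  by rewrite -[RHS]mulmx1 -(mulmxV uA) mulmxA HA mul1mx.
(* P m stands for the m-th partial derivative of E at x. *)
have [P PE] : exists P : 'I_n -> 'M[R]_n, forall m, partial m E x = P m.
  by exists (fun m => partial m E x).
have Psym a b c : P a c b = P b c a by rewrite -!PE; exact: Esym.
have Dg m a b : partial m g x a b =
    \sum_c (P m c a * E x c b + E x c a * P m c b).
  rewrite (partial_eq_on m oU gE Ux) (partial_mulmx m (differentiable_trmx dE) dE).
  rewrite (partial_trmx m dE) PE !mxE -big_split.
  by apply: eq_bigr => c _; rewrite !mxE.
have [G GE] : exists G : 'I_n -> 'M[R]_n, forall m, partial m g x = G m.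
  by exists (fun m => partial m g x).
rewrite /christoffel_symbol PE.
under eq_bigr => l _ do rewrite !GE.
have {GE}Dg m a b : G m a b = \sum_c (P m c a * E x c b + E x c a * P m c b).
  by rewrite -GE Dg.
have S l : G i j l + G j i l - G l i j = 2 * ((E x)^T *m P i) l j.
  rewrite !Dg -big_split -sumrB mxE mulr_sumr.
  apply: eq_bigr => c _; rewrite mxE /=.
  rewrite (Psym j i) (Psym l i) (Psym l j); ring.
under eq_bigr => l _ do rewrite S mulrCA.
rewrite -mulr_sumr mulrA mulVf ?pnatr_eq0 // mul1r.
transitivity ((invmx (g x) *m ((E x)^T *m P i)) k j).
  by rewrite [RHS]mxE.
by rewrite invg !mulmxA -(mulmxA (H x)) -trmx_mul EH trmx1 mulmx1.
Qed.

(** [Esym] is the integrability condition making the columns of [E] the partial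
    derivatives of a local map to Euclidean space, that is, of flat coordinates. *)
Lemma riemann_tensor_coframe x : U x ->
  forall l i j k, riemann_tensor g l i j k x = 0.
Proof.
move=> Ux l i j k; have dE := smooth_on_diff sE Ux.
have dH := smooth_on_diff sH Ux.
have dP m : differentiable (partial m E) x.
  exact: smooth_on_diff (smooth_on_partial m sE) Ux.
have [P PE] : exists P : 'I_n -> 'M[R]_n, forall m, partial m E x = P m.
  by exists (fun m => partial m E x).
have [Q QE] : exists Q : 'I_n -> 'I_n -> 'M[R]_n,
    forall a b, partial a (partial b E) x = Q a b.
  by exists (fun a b => partial a (partial b E) x).
have Qsym : Q i j = Q j i by rewrite -!QE; exact: (partial_comm_mx i j oU sE Ux).
have D a b c d : partial a (christoffel_symbol g b c d) x =
    (H x *m Q a c - H x *m P a *m (H x *m P c)) b d.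
  have C y (Uy : U y) := christoffel_coframe b c d Uy.
  rewrite (partial_eq_on a oU C Ux).
  rewrite -(partial_mxE a b d (differentiable_mulmx dH (dP c))).
  rewrite (partial_mulmx a dH (dP c)) (partial_left_inverse a oU HE Ux dH dE).
  by rewrite PE PE QE mulNmx addrC !mulmxA.
rewrite /riemann_tensor (D i l j k) (D j l i k) sumrB.
have S a b : \sum_m christoffel_symbol g l a m x * christoffel_symbol g m b k x
    = (H x *m P a *m (H x *m P b)) l k.
  rewrite [RHS]mxE; apply: eq_bigr => m _.
  by rewrite (christoffel_coframe l a m Ux) (christoffel_coframe m b k Ux) PE PE.
rewrite (S i j) (S j i) Qsym.
set A := H x *m Q j i; set B := H x *m P i *m _; set C := H x *m P j *m _.
rewrite [(A - B) l k]mxE [(- B) l k]mxE [(A - C) l k]mxE [(- C) l k]mxE; ring.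
Qed.

End Flatness.

(** * Algebra of the Lorentzian form *)

Section LorentzAlgebra.
Context {R : comPzRingType}.

(** The [i]-th diagonal entry of [lorentz R m], which is [-1] exactly at the last
    index. *)
Definition sgn (m : nat) (i : 'I_m) : R := if i.+1 == m then -1 else 1.

Lemma sgn_sqr m (i : 'I_m) : sgn i * sgn i = 1.
Proof. by rewrite /sgn; case: ifP => _; rewrite ?mulrNN mulr1. Qed.

Lemma lorentz_diag m : lorentz R m = diag_mx (\row_i sgn i).
Proof. by apply/matrixP => i j; rewrite !mxE /sgn; case: eqP => // ->. Qed.

Lemma lorentz_sqr m : lorentz R m *m lorentz R m = 1%:M.
Proof.
rewrite lorentz_diag mulmx_diag -diag_const_mx; congr diag_mx.
by apply/rowP => i; rewrite !mxE sgn_sqr.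
Qed.

Lemma lorentz_block n : (0 < n)%N ->
  lorentz R (n + n) = block_mx 1%:M 0 0 (lorentz R n).
Proof.
move=> n0; apply/matrixP => a b.
case: (split_ordP a) => i ->; case: (split_ordP b) => j ->;
  rewrite ?(block_mxEul, block_mxEur, block_mxEdl, block_mxEdr) !mxE.
- rewrite (inj_eq (@lshift_inj _ _)); case: eqP => //= _.
  by rewrite ltn_eqF //; apply: leq_ltn_trans (ltn_ord i) _; rewrite -addn1 leq_add2l.
- by rewrite eq_lrshift.
- by rewrite eq_rlshift.
- rewrite (inj_eq (@rshift_inj _ _)) /= -addnS eqn_add2l; by [].
Qed.

Lemma ipE m (x y : 'cV[R]_m) : ip x y = \sum_i sgn i * (x i 0 * y i 0).
Proof.
rewrite /ip lorentz_diag mxE; apply: eq_bigr => i _.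
by rewrite mul_mx_diag !mxE mulrAC mulrA [sgn i * _]mulrC mulrAC.
Qed.

Lemma ipC m (x y : 'cV[R]_m) : ip x y = ip y x.
Proof. by rewrite !ipE; apply: eq_bigr => i _; rewrite [x i 0 * _]mulrC. Qed.

Lemma ipDl m (x y z : 'cV[R]_m) : ip (x + y) z = ip x z + ip y z.
Proof. by rewrite /ip linearD /= !mulmxDl mxE. Qed.

Lemma ipZl m a (x z : 'cV[R]_m) : ip (a *: x) z = a * ip x z.
Proof. by rewrite /ip linearZ /= -!scalemxAl mxE. Qed.

Lemma ip0l m (z : 'cV[R]_m) : ip 0 z = 0.
Proof. by rewrite /ip trmx0 !mul0mx mxE. Qed.

Lemma ipDr m (x y z : 'cV[R]_m) : ip z (x + y) = ip z x + ip z y.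
Proof. by rewrite ipC ipDl !(ipC z). Qed.

Lemma ipZr m a (x z : 'cV[R]_m) : ip z (a *: x) = a * ip z x.
Proof. by rewrite ipC ipZl (ipC z). Qed.

Lemma ip_isometry m (P : 'M[R]_m) (x y : 'cV[R]_m) :
  in_O P -> ip (P *m x) (P *m y) = ip x y.
Proof. by move=> OP; rewrite /ip -[in RHS]OP trmx_mul !mulmxA. Qed.

Lemma ip_col_mx n (a a' b b' : 'cV[R]_n) : (0 < n)%N ->
  ip (col_mx a b) (col_mx a' b') = (a^T *m a') 0 0 + ip b b'.
Proof.
move=> n0; rewrite /ip lorentz_block // tr_col_mx mul_row_block !mulmx0 mulmx1.
by rewrite addr0 add0r mul_row_col mxE.
Qed.

Lemma ip_deltar m (x : 'cV[R]_m) i : ip x (delta_mx i 0) = sgn i * x i 0.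
Proof.
rewrite ipE (bigD1 i) //= mxE !eqxx mulr1 big1 ?addr0 // => j ji.
by rewrite mxE (negPf ji) !mulr0.
Qed.

Lemma delta_lorentz n (i : 'I_n) :
  delta_mx i i *m lorentz R n = sgn i *: delta_mx i i.
Proof.
rewrite lorentz_diag; apply/matrixP => a b; rewrite mul_mx_diag !mxE.
by rewrite mulrC; have [->|_] := eqVneq b i; rewrite ?andbF ?mulr0.
Qed.

Lemma delta_lorentz_mul n (i : 'I_n) (y : 'cV[R]_n) :
  delta_mx i i *m lorentz R n *m y = (sgn i * y i 0) *: delta_mx i 0.
Proof.
rewrite delta_lorentz -scalemxAl -scalerA; congr (_ *: _).
apply/colP => a; rewrite !mxE (bigD1 i) //= big1 => [|k ki]; last first.
  by rewrite mxE (negPf ki) andbF mul0r.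
by rewrite mxE !eqxx !andbT addr0 mulrC.
Qed.

Lemma col_mx_tangent_sum n (a : 'cV[R]_n) :
  col_mx a 0 = \sum_(i < n) a i 0 *: col_mx (delta_mx i 0 : 'cV[R]_n) (0 : 'cV[R]_n).
Proof.
apply/colP => k; rewrite summxE; case: (split_ordP k) => l ->.
  rewrite col_mxEu (bigD1 l) //= big1 => [|i il].
    by rewrite mxE col_mxEu mxE !eqxx mulr1 addr0.
  by rewrite mxE col_mxEu mxE eq_sym (negPf il) mulr0.
by rewrite col_mxEd mxE big1 // => i _; rewrite mxE col_mxEd mxE mulr0.
Qed.

Lemma col_mx_normal_sum n (a : 'cV[R]_n) :
  col_mx 0 a = \sum_(i < n) a i 0 *: col_mx (0 : 'cV[R]_n) (delta_mx i 0 : 'cV[R]_n).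
Proof.
apply/colP => k; rewrite summxE; case: (split_ordP k) => l ->.
  by rewrite col_mxEu mxE big1 // => i _; rewrite mxE col_mxEu mxE mulr0.
rewrite col_mxEd (bigD1 l) //= big1 => [|i il].
  by rewrite mxE col_mxEd mxE !eqxx mulr1 addr0.
by rewrite mxE col_mxEd mxE eq_sym (negPf il) mulr0.
Qed.

Lemma in_O_inv m (P : 'M[R]_m) : in_O P ->
  lorentz R m *m P^T *m lorentz R m *m P = 1%:M.
Proof.
by rewrite /in_O => OP; rewrite -!mulmxA (mulmxA P^T) OP lorentz_sqr.
Qed.

End LorentzAlgebra.

Section NullVectors.
Context {R : realFieldType}.

Lemma sgn_neq0 m (i : 'I_m) : sgn i != 0 :> R.
Proof. by rewrite /sgn; case: ifP => _; rewrite ?oppr_eq0 oner_eq0. Qed.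

(** Eliminating the last coordinate between the two vectors gives a vector whose
    square is both a sum of squares and non-positive. *)
Lemma null_orthogonal_timelike m (t x : 'cV[R]_m) :
  ip t t = -1 -> ip x x = 0 -> ip x t = 0 -> x = 0.
Proof.
case: m t x => [|m] t x tt xx xt; first by apply/matrixP => -[].
have lastE (y : 'cV[R]_m.+1) : ip y y =
    \sum_(i < m) y (widen_ord (leqnSn m) i) 0 ^+ 2 - y ord_max 0 ^+ 2.
  rewrite ipE big_ord_recr /= /sgn /= eqxx mulN1r -expr2; congr (_ - _).
  by apply: eq_bigr => i _; rewrite /= eqSS ltn_eqF // mul1r expr2.
have sq0 (y : 'cV[R]_m.+1) : y ord_max 0 = 0 -> 0 <= ip y y.
  by move=> y0; rewrite lastE y0 expr0n subr0 sumr_ge0 // => i _; exact: sqr_ge0.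
pose y := t ord_max 0 *: x + (- x ord_max 0) *: t.
have y0 : y ord_max 0 = 0 by rewrite !mxE; ring.
have yy : ip y y = - x ord_max 0 ^+ 2.
  by rewrite /y !(ipDl, ipDr, ipZl, ipZr) xx tt (ipC t) xt; ring.
have x0 : x ord_max 0 = 0.
  by apply/eqP; rewrite -sqrf_eq0 eq_le sqr_ge0 andbT -oppr_ge0 -yy sq0.
have := lastE x; rewrite xx x0 expr0n subr0 => /esym /eqP.
rewrite psumr_eq0 => [/allP H|i _]; last exact: sqr_ge0.
apply/colP => i; rewrite mxE; case: (unliftP ord_max i) => [j ->|-> //].
have := H j (mem_index_enum _); rewrite sqrf_eq0 => /eqP <-.
by congr (x _ 0); apply: val_inj; rewrite /= /bump leqNgt ltn_ord add0n.
Qed.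

End NullVectors.

(** * Real frames from an extended flat frame *)

(** The upper diagonal block of [[a_i, Xi]], where [Xi = p_mx eta]: the connection
    form of [g1]. *)
Definition tangent_block {R : comPzRingType} n (i : 'I_n) (eta : 'M[R]_n) : 'M[R]_n :=
  eta^T *m lorentz R n *m delta_mx i i - delta_mx i i *m lorentz R n *m eta.

(** The lower diagonal block of [[a_i, Xi]]: the connection form of [g2]. *)
Definition normal_block {R : comPzRingType} n (i : 'I_n) (eta : 'M[R]_n) : 'M[R]_n :=
  eta *m (delta_mx i i *m lorentz R n) - delta_mx i i *m (eta^T *m lorentz R n).

Section Frames.
Context {R : realType}.

Lemma toCE p q (A : 'M[R]_(p, q)) : toC A = map_mx (real_complex R) A.
Proof. by []. Qed.

Lemma toC_inj p q : injective (@toC R p q).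
Proof. by move=> A B; apply: map_mx_inj; exact: complexI. Qed.

Lemma toC_lorentz m : toC (lorentz R m) = lorentz R[i] m.
Proof.
apply/matrixP => i j; rewrite !mxE; case: eqP => _; last exact: rmorph0.
by case: eqP => _; rewrite ?rmorphN rmorph1.
Qed.

Lemma toC_re_mx p q (A : 'M[R[i]]_(p, q)) : conj_mx A = A -> A = toC (re_mx A).
Proof.
move=> cA; apply/matrixP => i j; have := congr1 (fun B : 'M[R[i]]_(p, q) => B i j) cA.
rewrite !mxE; case: (A i j) => a b /= [] /eqP; rewrite eq_sym -addr_eq0 -mulr2n.
by rewrite mulrn_eq0 /= => /eqP ->.
Qed.

Lemma in_O_toC m (A : 'M[R]_m) : in_O (toC A) -> in_O A.
Proof.
rewrite /in_O -toC_lorentz !toCE map_trmx -!map_mxM => /toC_inj; exact.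
Qed.

Lemma in_O_unitmx m (A : 'M[R]_m) : in_O A -> A \in unitmx.
Proof. by move/in_O_inv/mulmx1_unit => [_]. Qed.

(** A fixed point of [tau] is block diagonal. *)
Lemma tau_fixed n (G : 'M[R]_(n + n)) : tau (toC G) = toC G ->
  G = block_mx (ulsubmx G) 0 0 (drsubmx G).
Proof.
have toC_rho : rho R[i] n = toC (rho R n).
  rewrite /rho toCE map_block_mx map_mxN map_mx1; congr block_mx;
    by rewrite map_mx0.
have rho2 : rho R n *m rho R n = 1%:M.
  rewrite /rho mulmx_block !mulmx0 !mul0mx !mulmx1 mulNmx mul1mx opprK.
  by rewrite !addr0 add0r -scalar_mx_block.
have [ur _] := mulmx1_unit rho2.
rewrite /tau toC_rho !toCE -map_invmx -!map_mxM => /toC_inj.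
move/(congr1 (mulmx^~ (rho R n))) => /=; rewrite -mulmxA (mulVmx ur) mulmx1.
rewrite -{1 2 3}[G]submxK /rho !mulmx_block.
rewrite !(mul1mx, mul0mx, mulmx0, mulmx1, addr0, add0r, mulNmx, mulmxN) => E.
have z p q (A : 'M[R]_(p, q)) : A = - A -> A = 0.
  move=> /matrixP AE; apply/matrixP => a b; have := AE a b; rewrite !mxE; lra.
have [_ H1 H2 _] := eq_block_mx E.
by rewrite (z _ _ _ H1) -(z _ _ _ (esym H2)) ?submxK.
Qed.

Lemma lie_a_p n (i : 'I_n) (eta : 'M[R]_n) :
  lie (a_mx R i) (p_mx eta) =
  block_mx (tangent_block i eta) 0 0 (normal_block i eta).
Proof.
rewrite /lie /a_mx /p_mx !mulmx_block opp_block_mx add_block_mx.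
rewrite !(mul0mx, mulmx0, addr0, add0r, oppr0) !(mulmxN, mulNmx) !opprK.
by congr block_mx; rewrite addrC.
Qed.

(** The real data carried by an extended flat frame: the frame [P] at parameter
    [1], the diagonal blocks [g1] and [g2] of the frame at parameter [0], and the
    matrix [eta] with [Xi = p_mx eta], through which both connection forms are
    expressed. *)
Record frame_pair n (P : 'rV[R]_n -> 'M[R]_(n + n))
    (g1 g2 eta : 'rV[R]_n -> 'M[R]_n) : Prop := FramePair {
  frame_smooth : smooth_on setT P;
  frame1_smooth : smooth_on setT g1;
  frame2_smooth : smooth_on setT g2;
  frame_orth : forall x, in_O (P x);
  frame1_orth : forall x, (g1 x)^T *m g1 x = 1%:M;
  frame2_orth : forall x, in_O (g2 x);
  frame_partial : forall i x, partial i P x = P x *m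
    block_mx (tangent_block i (eta x)) (delta_mx i i *m lorentz R n)
             (- delta_mx i i) (normal_block i (eta x));
  frame1_partial : forall i x, partial i g1 x = g1 x *m tangent_block i (eta x);
  frame2_partial : forall i x, partial i g2 x = g2 x *m normal_block i (eta x)
}.

Lemma partialC_real n p q (i : 'I_n) (F : 'rV[R]_n -> 'M[R]_(p, q)) x :
  partialC i (fun y => toC (F y)) x = toC (partial i F x).
Proof.
rewrite /partialC.
have -> : (fun y => re_mx (toC (F y))) = F.
  by apply/funext => y; apply/matrixP => a b; rewrite !mxE.
have -> : (fun y => im_mx (toC (F y))) = cst 0.
  by apply/funext => y; apply/matrixP => a b; rewrite !mxE.
by rewrite partial_cst [toC 0]map_mx0 scaler0 addr0.
Qed.

(** The conjugation symmetry makes the frames at the parameters [0] and [1] real,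
    and the symmetry under [tau] makes the frame at [0] block diagonal. *)
Lemma frame_pair_of_extended n (n_gt0 : (0 < n)%N)
    (Xi : 'rV[R]_n -> 'M[R]_(n + n)) (Phi : R[i] -> 'rV[R]_n -> 'M[R[i]]_(n + n)) :
  UK_system Xi -> extended_flat_frame Xi Phi ->
  exists P g1 g2 eta, [/\ frame_pair P g1 g2 eta,
    forall x, Phi 1 x = toC (P x) &
    forall x, Phi 0 x = toC (block_mx (g1 x) 0 0 (g2 x))].
Proof.
move=> [_ Xip _] [sPhi OPhi dPhi cPhi tPhi].
have oT : open (setT : set 'rV[R]_n) by exact: openT.
pose P x := re_mx (Phi 1 x); pose G x := re_mx (Phi 0 x).
have PE x : Phi 1 x = toC (P x).
  by apply: toC_re_mx; rewrite cPhi; congr (Phi _ x); exact: conjc1.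
have G0E x : Phi 0 x = toC (G x).
  by apply: toC_re_mx; rewrite cPhi; congr (Phi _ x); exact: conjc0.
pose g1 x := ulsubmx (G x); pose g2 x := drsubmx (G x).
have GE x : G x = block_mx (g1 x) 0 0 (g2 x).
  by apply: tau_fixed; rewrite -G0E tPhi oppr0.
pose eta x := - dlsubmx (Xi x).
have XiE x : Xi x = p_mx (eta x).
  have [_ [h Eh]] := Xip x; rewrite {1}Eh; congr p_mx.
  by rewrite /eta Eh /p_mx block_mxKdl opprK.
have sP : smooth_on setT P by exact: (sPhi 1).1.
have sG : smooth_on setT G by exact: (sPhi 0).1.
have OP x : in_O (P x) by apply: in_O_toC; rewrite -PE.
have OG x : in_O (G x) by apply: in_O_toC; rewrite -G0E.
have frameE (lam : R) (H : 'rV[R]_n -> 'M[R]_(n + n)) i x :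
    (forall y, Phi (real_complex R lam) y = toC (H y)) -> in_O (H x) ->
    partial i H x = H x *m (lam *: a_mx R i + lie (a_mx R i) (Xi x)).
  move=> HE OH; have uH := in_O_unitmx OH.
  have := dPhi (real_complex R lam) i x.
  have -> : Phi (real_complex R lam) = fun y => toC (H y) by exact/funext.
  rewrite partialC_real /theta !toCE -map_mxZ -map_mxD -map_invmx -map_mxM.
  by move/toC_inj => <-; rewrite mulKVmx.
have sg1 : smooth_on setT g1.
  apply/(smooth_on_mxP _ oT) => a b.
  rewrite (_ : (fun x => _) = fun x => G x (lshift n a) (lshift n b)).
    exact: smooth_on_entry.
  by apply/funext => x; rewrite /g1 !mxE.
have sg2 : smooth_on setT g2.
  apply/(smooth_on_mxP _ oT) => a b.
  rewrite (_ : (fun x => _) = fun x => G x (rshift n a) (rshift n b)).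
    exact: smooth_on_entry.
  by apply/funext => x; rewrite /g2 !mxE.
have dG i x : block_mx (partial i g1 x) 0 0 (partial i g2 x) =
  block_mx (g1 x *m tangent_block i (eta x)) 0 0 (g2 x *m normal_block i (eta x)).
  have dGx : differentiable G x by exact: smooth_on_diff sG _.
  have := frameE 0 G i x G0E (OG x).
  rewrite scale0r add0r XiE lie_a_p GE mulmx_block.
  rewrite !(mul0mx, mulmx0, addr0, add0r) => <-.
  rewrite -[RHS]submxK; congr block_mx; apply/matrixP => a b; rewrite !mxE.
  - rewrite partial_mxE ?partial_mxE //; last exact: smooth_on_diff sg1 _.
    by congr (partial i _ x); apply/funext => y; rewrite /g1 !mxE.
  - rewrite partial_mxE // (_ : (fun y => _) = cst 0) ?partial_cst //.
    by apply/funext => y; rewrite GE block_mxEur mxE.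
  - rewrite partial_mxE // (_ : (fun y => _) = cst 0) ?partial_cst //.
    by apply/funext => y; rewrite GE block_mxEdl mxE.
  - rewrite partial_mxE ?partial_mxE //; last exact: smooth_on_diff sg2 _.
    by congr (partial i _ x); apply/funext => y; rewrite /g2 !mxE.
exists P, g1, g2, eta; split; [|exact: PE|by move=> x; rewrite G0E GE].
have OGE x : block_mx ((g1 x)^T *m g1 x) 0 0 ((g2 x)^T *m lorentz R n *m g2 x) =
    block_mx 1%:M 0 0 (lorentz R n).
  rewrite -lorentz_block // -(OG x) GE tr_block_mx !trmx0 lorentz_block //.
  by rewrite !mulmx_block !(mul0mx, mulmx0, addr0, add0r, mulmx1).
split=> //.
- by move=> x; have [] := eq_block_mx (OGE x).
- by move=> x; have [] := eq_block_mx (OGE x).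
- move=> i x; rewrite (frameE 1 P i x PE (OP x)) scale1r XiE lie_a_p /a_mx.
  by rewrite add_block_mx !(addr0, add0r).
- by move=> i x; have [] := eq_block_mx (dG i x).
- by move=> i x; have [] := eq_block_mx (dG i x).
Qed.

End Frames.

(** * The lift and its fundamental forms *)

Section Immersions.
Context {R : realType} {n : nat}.

Lemma ip_diff N (F : 'rV[R]_n -> 'cV[R]_N) x X : differentiable F x ->
  ip ('d F x X) ('d F x X) = (X *m first_ff F x *m X^T) 0 0.
Proof.
move=> dF; rewrite (diff_partial X dF).
have [D DE] : exists D : 'I_n -> 'cV[R]_N, forall i, partial i F x = D i.
  by exists (fun i => partial i F x).
have -> : first_ff F x = \matrix_(i, j) ip (D i) (D j).
  by apply/matrixP => i j; rewrite !mxE (DE i) (DE j).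
under eq_bigr do rewrite DE.
have suml (I : finType) (G : I -> 'cV[R]_N) y :
    ip (\sum_i G i) y = \sum_i ip (G i) y.
  apply: (big_morph (fun z => ip z y)) => [a b|]; first exact: ipDl.
  exact: ip0l.
rewrite suml [RHS]mxE.
under [RHS]eq_bigr => j _ do rewrite !mxE mulr_suml.
rewrite exchange_big; apply: eq_bigr => i _ /=.
rewrite ipC suml; apply: eq_bigr => j _.
by rewrite mxE ipZl ipZr (ipC (D j)); ring.
Qed.

Lemma immersive_of_posdef N (F : 'rV[R]_n -> 'cV[R]_N) x : differentiable F x ->
  (forall X : 'rV[R]_n, X != 0 -> 0 < (X *m first_ff F x *m X^T) 0 0) ->
  immersive_at F x.
Proof.
move=> dF pos; split=> // X Y XY; apply/eqP; rewrite -subr_eq0.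
apply: contraT => /pos; rewrite -ip_diff // linearB /= XY subrr.
by rewrite ip0l ltxx.
Qed.

End Immersions.

(** [Omega k] is [g1^-1 d_k E] for the coframe [E = g1 diag(sgn l * q_l)], with the
    derivative of [q] replaced by its value [- normal_block k eta *m q]. *)
Lemma coframe_closed {R : comPzRingType} n (eta : 'M[R]_n) (q : 'cV[R]_n) i j b :
  let Omega k : 'M[R]_n := tangent_block k eta *m diag_mx (\row_l (sgn l * q l 0))
    + diag_mx (\row_l (sgn l * (- (normal_block k eta *m q)) l 0)) in
  Omega i b j = Omega j b i.
Proof.
move=> Omega; have [->//|ij] := eqVneq i j.
have dl k (A : 'M[R]_n) a m : (delta_mx k k *m A) a m = (a == k)%:R * A k m.
  rewrite mxE (bigD1 k) //= big1 => [|l lk]; last first.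
    by rewrite mxE (negPf lk) andbF mul0r.
  by rewrite mxE eqxx andbT addr0.
have dr k (A : 'M[R]_n) a m : (A *m delta_mx k k) a m = A a k * (m == k)%:R.
  rewrite mxE (bigD1 k) //= big1 => [|l lk]; last first.
    by rewrite mxE (negPf lk) mulr0.
  by rewrite mxE eqxx addr0.
have T k m a : m != k -> tangent_block k eta a m = - ((a == k)%:R * (sgn k * eta k m)).
  move=> mk; rewrite mxE dr (negPf mk) mulr0 add0r mxE -mulmxA dl lorentz_diag.
  by rewrite mul_diag_mx !mxE.
have N k m : m != k -> (normal_block k eta *m q) m 0 = eta m k * (sgn k * q k 0).
  move=> mk; have NE l : normal_block k eta m l = sgn k * (eta m k * (l == k)%:R).
    rewrite /normal_block delta_lorentz -scalemxAr mxE [X in X + _]mxE dr.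
    by rewrite [X in _ + X]mxE dl (negPf mk) mul0r oppr0 addr0.
  rewrite mxE (bigD1 k) //= big1 => [|l lk]; rewrite NE.
    by rewrite eqxx mulr1 addr0; ring.
  by rewrite (negPf lk) !mulr0 mul0r.
have S k m : m != k -> Omega k b m = - ((b == k)%:R * (sgn k * eta k m)) * (sgn m * q m 0)
    - (b == m)%:R * (sgn m * (eta m k * (sgn k * q k 0))).
  move=> mk; rewrite /Omega mxE mul_mx_diag [X in X + _]mxE (T k m b mk).
  rewrite [(\row_l _) _ _]mxE; congr (_ + _).
  rewrite mxE [(\row_l _) _ _]mxE; have [->|_] := eqVneq b m; last by rewrite mul0r oppr0.
  by rewrite mulr1n [(- (_ *m _)) _ _]mxE (N k m mk) mul1r mulrN.
have ji : j != i by rewrite eq_sym.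
apply: etrans (S i j ji) _; apply: etrans _ (esym (S j i ij)); ring.
Qed.

Section Geometry.
Context {R : realType} {n : nat}.
Variables (P : 'rV[R]_n -> 'M[R]_(n + n)) (g1 g2 eta : 'rV[R]_n -> 'M[R]_n).
Hypothesis n_gt0 : (0 < n)%N.
Hypothesis fr : frame_pair P g1 g2 eta.

Let oT : open (setT : set 'rV[R]_n) := openT.

Lemma invmx_frame2 x : invmx (g2 x) = lorentz R n *m (g2 x)^T *m lorentz R n.
Proof.
have O2 := frame2_orth fr x; have u2 := in_O_unitmx O2.
by rewrite -[LHS]mul1mx -(in_O_inv O2) mulmxK.
Qed.

Lemma smooth_invmx_frame2 : smooth_on setT (fun x => invmx (g2 x)).
Proof.
rewrite (_ : (fun x => _) = fun x => lorentz R n *m (g2 x)^T *m lorentz R n).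
  apply: smooth_on_mulmx => //; last exact: smooth_on_cst.
  apply: smooth_on_mulmx => //; first exact: smooth_on_cst.
  apply: smooth_on_trmx => //; exact: frame2_smooth fr.
by apply/funext => x; exact: invmx_frame2.
Qed.

Lemma partial_invmx_frame2 i x :
  partial i (fun y => invmx (g2 y)) x =
  - (normal_block i (eta x) *m invmx (g2 x)).
Proof.
have V y : setT y -> invmx (g2 y) *m g2 y = 1%:M.
  by move=> _; exact: mulVmx (in_O_unitmx (frame2_orth fr y)).
rewrite (partial_left_inverse (U := setT) i oT V) //.
- by rewrite (frame2_partial fr) mulmxA (V x) // mul1mx.
- exact: smooth_on_diff smooth_invmx_frame2 _.
- exact: smooth_on_diff (frame2_smooth fr) _.
Qed.

Lemma partial_frame_mul p i x (a b : 'M[R]_(n, p)) :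
  partial i P x *m col_mx a b = P x *m
    col_mx (tangent_block i (eta x) *m a + delta_mx i i *m lorentz R n *m b)
           (- (delta_mx i i *m a) + normal_block i (eta x) *m b).
Proof. by rewrite (frame_partial fr) -[LHS]mulmxA mul_block_col mulNmx. Qed.

(** The last [n] columns of [P diag(g1, g2)^-1]. They form a parallel frame of the
    normal bundle of every lift, where the lift is an immersion. *)
Definition normal_frame (x : 'rV[R]_n) : 'M[R]_(n + n, n) :=
  P x *m col_mx 0 (invmx (g2 x)).

Let normal_frameE : normal_frame =
  fun x => P x *m (col_mx 0 1%:M *m invmx (g2 x)).
Proof. by apply/funext => x; rewrite mul_col_mx mul0mx mul1mx. Qed.

Lemma smooth_normal_frame : smooth_on setT normal_frame.
Proof.
rewrite normal_frameE; apply: smooth_on_mulmx => //; first exact: frame_smooth fr.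
apply: smooth_on_mulmx => //; first exact: smooth_on_cst.
exact: smooth_invmx_frame2.
Qed.

(** The normal component vanishes: the connection form of [g2] is also the lower
    diagonal block of the connection form of [P]. *)
Lemma partial_normal_frame i x :
  partial i normal_frame x =
  P x *m col_mx (delta_mx i i *m lorentz R n *m invmx (g2 x)) 0.
Proof.
have dW : differentiable (fun y => invmx (g2 y)) x.
  exact: smooth_on_diff smooth_invmx_frame2 _.
have dN : differentiable (cst (col_mx 0 1%:M) : 'rV[R]_n -> 'M[R]_(n + n, n)) x.
  exact: differentiable_cst.
have dP : differentiable P x by exact: smooth_on_diff (frame_smooth fr) _.
rewrite normal_frameE (partial_mulmx i dP (differentiable_mulmx dN dW)).
rewrite (partial_mulmx i dN dW) partial_cst mul0mx add0r partial_invmx_frame2.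
rewrite !mul_col_mx !mul0mx !mul1mx partial_frame_mul !mulmx0 oppr0 !add0r -mulmxDr.
by rewrite add_col_mx addr0 subrr.
Qed.

Lemma tangent_col x i : col (lshift n i) (P x) = P x *m col_mx (delta_mx i 0) 0.
Proof.
rewrite colE; congr (_ *m _); apply/colP => a; case: (split_ordP a) => b ->.
  by rewrite col_mxEu !mxE !andbT (inj_eq (@lshift_inj _ _)).
by rewrite col_mxEd !mxE eq_rlshift.
Qed.

Lemma normal_col x i : col (rshift n i) (P x) = P x *m col_mx 0 (delta_mx i 0).
Proof.
rewrite colE; congr (_ *m _); apply/colP => a; case: (split_ordP a) => b ->.
  by rewrite col_mxEu !mxE eq_lrshift.
by rewrite col_mxEd !mxE !andbT (inj_eq (@rshift_inj _ _)).
Qed.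

Lemma ip_frame x (a a' b b' : 'cV[R]_n) :
  ip (P x *m col_mx a b) (P x *m col_mx a' b') = (a^T *m a') 0 0 + ip b b'.
Proof. by rewrite ip_isometry ?ip_col_mx //; exact: frame_orth fr x. Qed.

Lemma ip_frame_normal x (a b b' : 'cV[R]_n) :
  ip (P x *m col_mx 0 b) (P x *m col_mx a b') = ip b b'.
Proof. by rewrite ip_frame trmx0 mul0mx mxE add0r. Qed.

Lemma frame_inj p x (y z : 'M[R]_(n + n, p)) : P x *m y = P x *m z -> y = z.
Proof.
have u := in_O_unitmx (frame_orth fr x).
by move/(congr1 (mulmx (invmx (P x)))); rewrite !mulKmx.
Qed.

Section Lift.
Variable c : 'cV[R]_n.
Local Notation F := (Fmap P g2 c).
Local Notation q i x := (qvec g2 c x i 0).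
Local Notation e i x := (col (lshift n i) (P x)).
Local Notation u i x := (col (rshift n i) (P x)).
Local Notation U := (regular_set g2 c).

Lemma lift_normal_frame : F = fun x => normal_frame x *m c.
Proof.
by apply/funext => x; rewrite /normal_frame -mulmxA mul_col_mx mul0mx.
Qed.

Lemma smooth_lift : smooth_on setT F.
Proof.
rewrite lift_normal_frame; apply: smooth_on_mulmx => //.
  exact: smooth_normal_frame.
exact: smooth_on_cst.
Qed.

Let sF : smooth_on setT F := smooth_lift.

Lemma smooth_qvec i : smooth_on setT (fun x => q i x).
Proof.
apply: (@smooth_on_entry _ _ _ _ _ (fun x => qvec g2 c x)) => //.
apply: smooth_on_mulmx => //; [exact: smooth_invmx_frame2|exact: smooth_on_cst].
Qed.

Lemma partial_lift_frame i x : partial i F x =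
  P x *m col_mx (delta_mx i i *m lorentz R n *m qvec g2 c x) 0.
Proof.
have dM : differentiable normal_frame x.
  exact: smooth_on_diff smooth_normal_frame _.
have dc : differentiable (cst c : 'rV[R]_n -> 'cV[R]_n) x.
  exact: differentiable_cst.
rewrite lift_normal_frame (partial_mulmx i dM dc) partial_cst mulmx0 addr0.
by rewrite partial_normal_frame -[LHS]mulmxA mul_col_mx mul0mx /qvec [in RHS]mulmxA.
Qed.

Lemma partial_lift i x : partial i F x = (sgn i * q i x) *: e i x.
Proof.
rewrite partial_lift_frame delta_lorentz_mul tangent_col.
by rewrite scalemxAr scale_col_mx scaler0.
Qed.

Lemma lift_sum x : F x = \sum_(i < n) q i x *: u i x.
Proof.
rewrite /Fmap col_mx_normal_sum.
by rewrite mulmx_sumr; apply: eq_bigr => i _; rewrite -scalemxAr normal_col.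
Qed.

Lemma ip_tangent i j x : ip (e i x) (e j x) = (i == j)%:R.
Proof.
rewrite !tangent_col ip_frame trmx_delta mul_delta_mx_cond.
by rewrite /ip trmx0 !mul0mx [X in _ + X]mxE addr0 mulmxnE mxE eqxx; case: eqP.
Qed.

Lemma ip_normal_normal i x : ip (u i x) (u i x) = sgn i.
Proof.
rewrite normal_col ip_frame trmx0 mul0mx mxE add0r ip_deltar mxE !eqxx.
by rewrite mulr1.
Qed.

Lemma ip_normal_tangent i j x : ip (u i x) (e j x) = 0.
Proof.
rewrite normal_col tangent_col ip_frame trmx0 mul0mx.
by rewrite (ipC (delta_mx i 0)) ip0l addr0 mxE.
Qed.

Lemma first_ff_lift x i j : first_ff F x i j = (q i x ^+ 2) *+ (i == j).
Proof.
rewrite mxE (partial_lift i) (partial_lift j) ipZl ipZr ip_tangent.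
case: eqP => [->|_]; last by rewrite !mulr0.
rewrite mulr1 mulr1n; have := sgn_sqr (R := R) j; set s := sgn j => ss.
by rewrite -[RHS]mul1r -ss; ring.
Qed.

Lemma first_ff_lift_diag x : first_ff F x = diag_mx (\row_i (q i x ^+ 2)).
Proof.
apply/matrixP => i j; rewrite first_ff_lift; move: (qvec g2 c x) => r.
by rewrite !mxE; case: eqP => [->|].
Qed.

Lemma invmx_first_ff_lift x : U x ->
  invmx (first_ff F x) = diag_mx (\row_i (q i x ^- 2)).
Proof.
move=> Ux; have D : first_ff F x *m diag_mx (\row_i (q i x ^- 2)) = 1%:M.
  rewrite first_ff_lift_diag mulmx_diag -diag_const_mx; congr diag_mx.
  apply/rowP => i; move: (Ux i); move: (qvec g2 c x) => r r0.
  by rewrite !mxE divff // expf_neq0.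
have [uF _] := mulmx1_unit D.
by rewrite -[LHS]mulmx1 -D mulKmx.
Qed.

Lemma tangent_part_frame x (a b : 'cV[R]_n) : U x ->
  tangent_part F x (P x *m col_mx a b) = P x *m col_mx a 0.
Proof.
move=> Ux.
have [D DE] : exists D : 'I_n -> 'cV[R]_(n + n), forall i, partial i F x = D i.
  by exists (fun i => partial i F x).
have DE' i : D i = (sgn i * q i x) *: (P x *m col_mx (delta_mx i 0) 0).
  by rewrite -DE partial_lift tangent_col.
rewrite /tangent_part invmx_first_ff_lift //.
rewrite [in RHS]col_mx_tangent_sum mulmx_sumr.
apply: eq_bigr => i _.
rewrite (bigD1 i) //= big1 ?addr0 => [|j ji]; last first.
  by rewrite [diag_mx _ _ _]mxE eq_sym (negPf ji) mul0r scale0r.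
rewrite (DE i) (DE' i) [diag_mx _ _ _]mxE eqxx mulr1n [(\row__ _) _ _]mxE ipZr.
rewrite ip_frame ipC ip0l addr0 scalerA -[RHS]scalemxAr; congr (_ *: _).
have -> : (a^T *m (delta_mx i 0 : 'cV[R]_n)) 0 0 = a i 0.
  by rewrite -colE !mxE.
have q0 : q i x != 0 by exact: Ux.
have ss := sgn_sqr (R := R) i.
transitivity (a i 0 * (sgn i * sgn i)); last by rewrite ss mulr1.
by field.
Qed.

Lemma normal_part_frame x (a b : 'cV[R]_n) : U x ->
  normal_part F x (P x *m col_mx a b) = P x *m col_mx 0 b.
Proof.
move=> Ux; rewrite /normal_part tangent_part_frame // -mulmxBr.
by rewrite opp_col_mx add_col_mx subrr oppr0 addr0.
Qed.

Lemma second_ff_lift x i j : U x ->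
  second_ff F x i j = (- (ip (u i x) (u i x) * q i x) *: u i x) *+ (i == j).
Proof.
move=> Ux; rewrite /second_ff.
pose y z := delta_mx j j *m lorentz R n *m qvec g2 c z.
have sy : smooth_on setT y.
  apply: smooth_on_mulmx => //; first exact: smooth_on_cst.
  apply: smooth_on_mulmx => //; [exact: smooth_invmx_frame2|exact: smooth_on_cst].
have -> : partial j F = fun z => P z *m (col_mx 1%:M 0 *m y z).
  by apply/funext => z; rewrite partial_lift_frame mul_col_mx mul1mx mul0mx.
have dP : differentiable P x by exact: smooth_on_diff (frame_smooth fr) _.
have dN : differentiable (cst (col_mx 1%:M 0) : 'rV[R]_n -> 'M[R]_(n + n, n)) x.
  exact: differentiable_cst.
have dy : differentiable y x by exact: smooth_on_diff sy _.
rewrite (partial_mulmx i dP (differentiable_mulmx dN dy)) (partial_mulmx i dN dy).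
rewrite partial_cst mul0mx add0r !mul_col_mx !mul1mx !mul0mx partial_frame_mul.
rewrite !mulmx0 !addr0 -mulmxDr add_col_mx normal_part_frame // addr0.
have -> : delta_mx i i *m y x =
    ((sgn j * q j x) *: delta_mx j 0) *+ (i == j).
  rewrite /y delta_lorentz_mul -scalemxAr mul_delta_mx_cond.
  by case: eqP => [->|_] //=; rewrite !mulr0n scaler0.
case: eqP => [->|_]; last by rewrite !mulr0n oppr0 col_mx0 mulmx0.
rewrite !mulr1n ip_normal_normal normal_col scalemxAr scale_col_mx scaler0.
by rewrite scaleNr.
Qed.

Lemma open_regular_set : open U.
Proof.
rewrite openE => x Ux.
change (\forall y \near x, forall i, qvec g2 c y i 0 != 0).
apply: (@filter_forall _ _ (fun i y => qvec g2 c y i 0 != 0) (nbhs x)) => i.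
have := smooth_on_diff (smooth_qvec i) (I : setT x).
by move=> /differentiable_continuous /cvgr_neq0; apply; exact: Ux.
Qed.

Let oU : open U := open_regular_set.

Lemma differentiable_lift x : differentiable F x.
Proof. exact: smooth_on_diff sF _. Qed.

Lemma diff_lift x X : 'd F x X =
  P x *m col_mx (\col_i (X 0 i * (sgn i * q i x))) 0.
Proof.
rewrite (diff_partial X (differentiable_lift x)).
rewrite col_mx_tangent_sum mulmx_sumr; apply: eq_bigr => i _.
by rewrite (partial_lift i x) tangent_col scalerA -scalemxAr [(\col__ _) _ _]mxE.
Qed.

Lemma immersive_lift x : U x <-> immersive_at F x.
Proof.
split=> [Ux|[_ inj] i].
  split=> [|X Y]; first exact: differentiable_lift.
  rewrite !diff_lift => /frame_inj /eq_col_mx [/colP H _].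
  apply/rowP => i; have := H i; have := Ux i; move: (qvec g2 c x) => r r0.
  by rewrite !mxE => /mulIf; apply; rewrite mulf_neq0 ?sgn_neq0.
apply/negP => /eqP qi0.
have /inj /rowP /(_ i) : 'd F x (delta_mx 0 i) = 'd F x 0.
  rewrite !diff_lift; congr (_ *m col_mx _ _); apply/colP => j.
  move: (qvec g2 c x) qi0 => r r0; rewrite !mxE.
  have [->|_] := eqVneq j i; last by rewrite andbF !mul0r.
  by rewrite r0 !mulr0.
by rewrite !mxE !eqxx => /eqP; rewrite oner_eq0.
Qed.

Lemma riemannian_lift : riemannian U (first_ff F).
Proof.
split.
  apply/(smooth_on_mxP _ oU) => i j.
  have -> : (fun x => first_ff F x i j) = fun x => (i == j)%:R * (q i x * q i x).
    by apply/funext => x; rewrite first_ff_lift expr2 mulr_natl.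
  have sq : smooth_on U (fun x => q i x) by exact: smooth_onS (smooth_qvec i).
  apply: smooth_onM oU _ _; first exact: smooth_on_cst.
  exact: smooth_onM oU _ _.
move=> x Ux; split=> [|X X0].
  by rewrite first_ff_lift_diag tr_diag_mx.
rewrite first_ff_lift_diag mul_mx_diag mxE.
have E i : (\matrix_(a, b) (X a b * (\row_k (qvec g2 c x k 0 ^+ 2)) 0 b)) 0 i * X^T i 0
    = (X 0 i * q i x) ^+ 2.
  by rewrite /qvec !mxE; ring.
under eq_bigr do rewrite E.
have /rV0Pn [k Xk] := X0.
rewrite (bigD1 k) //= ltr_wpDr //; first by apply: sumr_ge0 => i _; exact: sqr_ge0.
by rewrite exprn_even_gt0 //= mulf_neq0 //; exact: Ux.
Qed.

(** The coframe is [g1 diag(sgn i * q_i)]. *)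
Lemma flat_lift_metric : flat_metric U (first_ff F).
Proof.
split; first exact: riemannian_lift.
pose d x : 'rV[R]_n := \row_i (sgn i * q i x).
pose E x := g1 x *m diag_mx (d x).
pose H x := diag_mx (\row_i (d x 0 i)^-1) *m (g1 x)^T.
have d0 x i : U x -> d x 0 i != 0.
  by move=> Ux; rewrite mxE mulf_neq0 ?sgn_neq0 //; exact: Ux.
have sq i : smooth_on U (fun x => q i x) by exact: smooth_onS (smooth_qvec i).
have sd i : smooth_on U (fun x => d x 0 i).
  rewrite (_ : (fun x => _) = fun x => sgn i * q i x).
    by apply: smooth_onM => //; exact: smooth_on_cst.
  by apply/funext => x; rewrite mxE.
have sdiag (b : 'rV[R]_n -> 'rV[R]_n) : (forall i, smooth_on U (fun x => b x 0 i)) ->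
    smooth_on U (fun x => diag_mx (b x)).
  move=> sb; apply/(smooth_on_mxP _ oU) => i j.
  rewrite (_ : (fun x => _) = fun x => (i == j)%:R * b x 0 i).
    by apply: smooth_onM => //; exact: smooth_on_cst.
  by apply/funext => x; rewrite mxE mulr_natl.
have sg1 : smooth_on U g1 by exact: smooth_onS (frame1_smooth fr).
have sD : smooth_on U (fun x => diag_mx (d x)) by exact: sdiag.
apply: (@riemann_tensor_coframe _ _ U (first_ff F) E H) => //.
- exact: smooth_on_mulmx.
- apply: smooth_on_mulmx => //; last exact: smooth_on_trmx.
  apply: sdiag => i; rewrite (_ : (fun x => _) = fun x => (d x 0 i)^-1).
    by apply: smooth_onV => // x; exact: d0.
  by apply/funext => x; rewrite mxE.
- move=> x Ux; rewrite /H /E mulmxA -(mulmxA _ (g1 x)^T) (frame1_orth fr) mulmx1.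
  rewrite mulmx_diag -diag_const_mx; congr diag_mx; apply/rowP => i.
  have := d0 x i Ux; move: (d x) => r r0; by rewrite !mxE mulVf.
- move=> x Ux; rewrite /E trmx_mul mulmxA -(mulmxA _ (g1 x)^T) (frame1_orth fr) mulmx1.
  rewrite first_ff_lift_diag tr_diag_mx mulmx_diag; congr diag_mx.
  apply/rowP => i; rewrite /d /qvec !mxE.
  have := sgn_sqr (R := R) i; move: (sgn i) => s ss.
  by rewrite -[LHS]mul1r -ss; ring.
move=> x Ux i j a.
have dg1 : differentiable g1 x by exact: smooth_on_diff sg1 _.
have dD : differentiable (fun x => diag_mx (d x)) x by exact: smooth_on_diff sD _.
have dq : differentiable (fun y => qvec g2 c y) x.
  have : smooth_on setT (fun y => qvec g2 c y).
    apply: smooth_on_mulmx => //; [exact: smooth_invmx_frame2|exact: smooth_on_cst].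
  by move=> s; exact: smooth_on_diff s _.
have pq k : partial k (fun y => qvec g2 c y) x =
    - (normal_block k (eta x) *m qvec g2 c x).
  have dW : differentiable (fun y => invmx (g2 y)) x.
    exact: smooth_on_diff smooth_invmx_frame2 _.
  have dc : differentiable (cst c : 'rV[R]_n -> 'cV[R]_n) x.
    exact: differentiable_cst.
  rewrite (partial_mulmx k dW dc) partial_cst mulmx0 addr0 partial_invmx_frame2.
  by rewrite mulNmx /qvec mulmxA.
have PE k : partial k E x = g1 x *m (tangent_block k (eta x) *m diag_mx (d x)
    + diag_mx (\row_l (sgn l * (- (normal_block k (eta x) *m qvec g2 c x)) l 0))).
  rewrite (partial_mulmx k dg1 dD) (frame1_partial fr) [RHS]mulmxDr.
  rewrite -[X in X + _ = _]mulmxA; congr (_ + g1 x *m _).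
  apply/matrixP => l m; rewrite (partial_mxE k l m dD).
  rewrite (_ : (fun y => _) = (fun y => cst ((l == m)%:R * sgn l) y * qvec g2 c y l 0)).
    rewrite partialM; last 2 first.
    + exact: differentiable_cst.
    + exact: ((differentiable_mxP (fun y => qvec g2 c y) x).1 dq l 0).
    rewrite partial_cst mul0r add0r -(partial_mxE k l 0 dq) pq.
    rewrite [diag_mx _ _ _]mxE [(\row_l0 _) _ _]mxE /cst.
    by case: (l == m); rewrite ?mulr1n ?mul1r // mulr0n !mul0r.
  apply/funext => y; rewrite [diag_mx _ _ _]mxE mxE /cst.
  by case: (l == m); rewrite ?mulr1n ?mul1r // mulr0n !mul0r.
move: {sD dD PE} (PE i) (PE j) => -> ->.
have mulE (A B : 'M[R]_n) : (forall b, A b j = B b i) ->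
    (g1 x *m A) a j = (g1 x *m B) a i.
  by move=> AB; rewrite mxE [RHS]mxE; apply: eq_bigr => b _; rewrite AB.
apply: mulE => b; exact: (coframe_closed (eta x) (qvec g2 c x) i j b).
Qed.

(** * The conformally flat immersion into the sphere *)

Section SphereMap.
Variable t0 : 'cV[R]_(n + n).
Hypothesis t0_unit : ip t0 t0 = -1.
Hypothesis c_neq0 : c != 0.
Hypothesis c_null : ip c c = 0.

Let h x : R := ip (F x) t0.
(* The factor for which k F - t0 is orthogonal to t0. *)
Let k x : R := - (h x)^-1.
Let f x := k x *: F x - t0.

Lemma lift_null x : ip (F x) (F x) = 0.
Proof.
rewrite /Fmap ip_frame trmx0 mul0mx mxE add0r.
rewrite -(ip_isometry _ _ (frame2_orth fr x)) /qvec mulKVmx //.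
exact: in_O_unitmx (frame2_orth fr x).
Qed.

Lemma lift_neq0 x : F x != 0.
Proof.
apply: contraNneq c_neq0 => Fx0.
have /frame_inj : P x *m col_mx 0 (qvec g2 c x) = P x *m col_mx 0 0.
  by rewrite col_mx0 mulmx0.
case/eq_col_mx => _ /(congr1 (mulmx (g2 x))).
by rewrite /qvec mulKVmx ?mulmx0 => [->|] //; exact: in_O_unitmx (frame2_orth fr x).
Qed.

Lemma ip_lift_partial x i : ip (F x) (partial i F x) = 0.
Proof.
rewrite (partial_lift_frame i x) ip_frame trmx0 mul0mx mxE add0r.
by rewrite ipC ip0l.
Qed.

Let h0 x : h x != 0.
Proof.
apply: contraNneq (lift_neq0 x) => hx.
by apply/eqP; exact: null_orthogonal_timelike t0_unit (lift_null x) hx.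
Qed.

Let sh : smooth_on setT h.
Proof.
rewrite (_ : h = fun x => ((F x)^T *m (lorentz R (n + n) *m t0)) 0 0).
  apply: (@smooth_on_entry _ _ _ _ _ (fun x => (F x)^T *m _)) => //.
  apply: smooth_on_mulmx => //; last exact: smooth_on_cst.
  exact: smooth_on_trmx.
by apply/funext => x; rewrite mulmxA.
Qed.

Let sk : smooth_on setT k.
Proof. by apply: smooth_onN => //; apply: smooth_onV => // x _; exact: h0. Qed.

Let sf : smooth_on setT f.
Proof.
apply/(smooth_on_mxP _ oT) => a b.
rewrite (_ : (fun x => _) = fun x => k x * F x a b + cst (- t0 a b) x).
  apply: smooth_onD => //; last exact: smooth_on_cst.
  by apply: smooth_onM => //; exact: smooth_on_entry.
by apply/funext => x; rewrite !mxE.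
Qed.

Lemma first_ff_sphere_map x : first_ff f x = k x ^+ 2 *: first_ff F x.
Proof.
have dk : differentiable k x by exact: smooth_on_diff sk _.
have dF : differentiable F x by exact: smooth_on_diff sF _.
have [D DE] : exists D : 'I_n -> 'cV[R]_(n + n), forall i, partial i F x = D i.
  by exists (fun i => partial i F x).
have [d dE] : exists d : 'I_n -> R, forall i, partial i k x = d i.
  by exists (fun i => partial i k x).
have pf i : partial i f x = d i *: F x + k x *: D i.
  have [dkF pkF] := partial_scale i dk dF.
  rewrite -dE -DE -pkF [LHS]deriveB; last 2 first.
  - exact: diff_derivable.
  - exact: derivable_cst.
  by rewrite derive_cst subr0.
have FD i : ip (F x) (D i) = 0 by rewrite -DE ip_lift_partial.
apply/matrixP => i j; rewrite mxE (pf i) (pf j) [RHS]mxE [first_ff F x i j]mxE.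
rewrite (DE i) (DE j) !ipDl !ipDr !ipZl !ipZr lift_null (FD j).
by rewrite (ipC (D i) (F x)) (FD i); ring.
Qed.

Lemma sphere_map_conformally_flat :
  conformally_flat_immersion t0 U f /\ flat_lift t0 U f F.
Proof.
have k0 x : k x != 0 by rewrite /k oppr_eq0 invr_eq0.
have [rF fF] := flat_lift_metric.
split; last first.
  split=> [|x _|x _|].
  - exact: smooth_onS sF.
  - exact: lift_null.
  - by exists (k x); rewrite /f subrK.
  - exact: flat_lift_metric.
split.
- split=> [|x Ux]; first exact: smooth_onS sf.
  apply: immersive_of_posdef => [|X X0]; first exact: smooth_on_diff sf _.
  rewrite first_ff_sphere_map -scalemxAr -scalemxAl mxE mulr_gt0 //.
    by rewrite exprn_even_gt0 //= k0.
  exact: (rF.2 x Ux).2.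
- move=> x _; split; rewrite /f.
    rewrite ipDl ipZl -scaleN1r ipZl t0_unit mulrNN mulr1 /k mulNr mulVf // addrC.
    by rewrite subrr.
  rewrite -scaleN1r !(ipDl, ipDr, ipZl, ipZr) lift_null t0_unit (ipC t0).
  rewrite -[ip (F x) t0]/(h x) /k; by field.
(* The conformal factor is chosen so that expR (2 * u) = h ^+ 2 = k ^- 2. *)
exists (fun x => ln (h x ^+ 2) / 2).
have h2 x : 0 < h x ^+ 2 by rewrite exprn_even_gt0 //= h0.
split.
  apply: smooth_onM => //; last exact: smooth_on_cst.
  apply: (smooth_on_ln oU) => //.
  rewrite (_ : (fun x => _) = fun x => h x * h x); last first.
    by apply/funext => x; rewrite expr2.
  by apply: smooth_onM => //; exact: smooth_onS sh.
rewrite (_ : (fun x => _) = first_ff F); first exact: flat_lift_metric.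
apply/funext => x; rewrite mulrC divfK ?pnatr_eq0 // lnK ?posrE //.
rewrite first_ff_sphere_map scalerA -exprMn /k mulrN divff // sqrrN expr1n.
by rewrite scale1r.
Qed.

End SphereMap.

(** * The normal bundle of the lift *)

(** Every normal field is a smooth combination of the parallel normal frame; its
    coefficients are read off from the coordinates in the frame [P]. *)
Lemma normal_field_frame O (v : 'rV[R]_n -> 'cV[R]_(n + n)) :
  open O -> O `<=` U -> normal_field O F v ->
  exists2 w : 'rV[R]_n -> 'cV[R]_n, smooth_on O w &
    forall y, O y -> v y = normal_frame y *m w y.
Proof.
move=> oO OU [sv nv].
pose z y := lorentz R (n + n) *m (P y)^T *m lorentz R (n + n) *m v y.
have sz : smooth_on O z.
  apply: smooth_on_mulmx => //; apply: smooth_on_mulmx => //; last exact: smooth_on_cst.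
  apply: smooth_on_mulmx => //; first exact: smooth_on_cst.
  apply: smooth_on_trmx => //; exact: smooth_onS (frame_smooth fr).
have vE y : v y = P y *m z y.
  have H := mulmx1C (in_O_inv (frame_orth fr y)).
  by rewrite /z mulmxA H mul1mx.
exists (fun y => g2 y *m dsubmx (z y)).
  apply: smooth_on_mulmx => //; first exact: smooth_onS (frame2_smooth fr).
  apply/(smooth_on_mxP _ oO) => a b.
  rewrite (_ : (fun x => _) = fun x => z x (rshift n a) b).
    exact: smooth_on_entry.
  by apply/funext => x; rewrite mxE.
move=> y Oy; rewrite /normal_frame -mulmxA mul_col_mx mul0mx mulKmx; last first.
  exact: in_O_unitmx (frame2_orth fr y).
rewrite vE -[z y in LHS]vsubmxK; congr (_ *m col_mx _ _).
apply/colP => i; have := nv y Oy i.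
rewrite (partial_lift i y) ipZr tangent_col vE -[z y]vsubmxK ip_frame.
rewrite col_mxKu -colE [X in _ * (_ + X)]ipC ip0l addr0 => /eqP.
rewrite [col _ _ _ _]mxE [_^T _ _]mxE [RHS]mxE mulf_eq0 => /orP[|/eqP //].
by rewrite mulf_eq0 (negPf (OU _ Oy i)) (negPf (sgn_neq0 i)).
Qed.

(** As [normal_frame] is parallel, the normal part only involves the derivative of
    the coefficients. *)
Lemma partial_normal_field O (v : 'rV[R]_n -> 'cV[R]_(n + n))
    (w : 'rV[R]_n -> 'cV[R]_n) i x : open O -> O x -> differentiable w x ->
  (forall y, O y -> v y = normal_frame y *m w y) ->
  partial i v x = P x *m col_mx
    ((sgn i * (invmx (g2 x) *m w x) i 0) *: delta_mx i 0)
    (invmx (g2 x) *m partial i w x).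
Proof.
move=> oO Ox dw vE; rewrite (partial_eq_on i oO vE Ox).
have dM : differentiable normal_frame x.
  exact: smooth_on_diff smooth_normal_frame _.
rewrite (partial_mulmx i dM dw) (partial_normal_frame i x) /normal_frame.
rewrite -!mulmxA -mulmxDr !mul_col_mx !mul0mx add_col_mx addr0 add0r.
by rewrite !mulmxA -(mulmxA (delta_mx i i *m _)) delta_lorentz_mul.
Qed.

Lemma flat_normal_bundle_lift V : V `<=` U -> flat_normal_bundle V F.
Proof.
move=> VU O v oO OV nv x Ox i j; have OU : O `<=` U by exact: subset_trans VU.
have [w sw vE] := normal_field_frame oO OU nv.
have nE l y (Oy : O y) : normal_connection F l v y = normal_frame y *m partial l w y.
  rewrite /normal_connection (partial_normal_field l oO Oy (smooth_on_diff sw Oy) vE).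
  rewrite (normal_part_frame _ _ (OU _ Oy)).
  by rewrite /normal_frame -[RHS]mulmxA mul_col_mx mul0mx.
have nE2 k l : normal_connection F k (normal_connection F l v) x
    = normal_frame x *m partial k (partial l w) x.
  have dw : differentiable (partial l w) x.
    exact: smooth_on_diff (smooth_on_partial l sw) Ox.
  rewrite [LHS]/normal_connection (partial_normal_field k oO Ox dw (nE l)).
  rewrite (normal_part_frame _ _ (OU _ Ox)).
  by rewrite /normal_frame -[RHS]mulmxA mul_col_mx mul0mx.
by rewrite (nE2 i j) (nE2 j i) (partial_comm_mx i j oO sw Ox).
Qed.

Lemma tangent_partZ x (a : R) y : tangent_part F x (a *: y) = a *: tangent_part F x y.
Proof.
rewrite /tangent_part scaler_sumr; apply: eq_bigr => i _.
rewrite scaler_sumr; apply: eq_bigr => j _.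
by rewrite ipZl scalerA; congr (_ *: _); ring.
Qed.

Lemma curvature_normal_lift x i (a : R) : U x -> a != 0 ->
  curvature_normal F x (a *: e i x)
    (- (ip (u i x) (u i x) * (q i x)^-1) *: u i x).
Proof.
move=> Ux a0.
have sg0 := sgn_neq0 (R := R) i.
have q0 : q i x != 0 by exact: Ux.
have dXE X : 'd F x X = a *: e i x -> X = (a * sgn i * (q i x)^-1) *: delta_mx 0 i.
  rewrite diff_lift tangent_col scalemxAr => /frame_inj.
  rewrite scale_col_mx => /eq_col_mx [/colP H _]; apply/rowP => j.
  rewrite [RHS]mxE [delta_mx 0 i _ _]mxE; have := H j.
  have -> : (a *: (delta_mx i 0 : 'cV[R]_n)) j 0 = a * (j == i)%:R.
    by rewrite !mxE eqxx andbT.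
  rewrite [(\col__ _) _ _]mxE !eqxx /=; have [->|ji] := eqVneq j i.
    rewrite !mulr1 => <-; have := sgn_sqr (R := R) i => ss.
    transitivity (X 0 i * (sgn i * sgn i)); first by rewrite ss mulr1.
    by field.
  rewrite !mulr0 => /eqP; rewrite !mulf_eq0 => /or3P[/eqP //||] /eqP z.
    by have := sgn_neq0 (R := R) j; rewrite z eqxx.
  by have := Ux j; rewrite /qvec z eqxx.
split.
- rewrite scaler_eq0 (negPf a0) /=; apply/eqP => /(congr1 (fun y => ip y y)).
  by rewrite ip_tangent eqxx ip0l => /eqP; rewrite oner_eq0.
- exists ((a * sgn i * (q i x)^-1) *: delta_mx 0 i); rewrite linearZ /=.
  have -> : 'd F x (delta_mx 0 i) = (sgn i * q i x) *: e i x.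
    rewrite -(deriveE _ (differentiable_lift x)); exact: partial_lift i x.
  rewrite scalerA; congr (_ *: _).
  have := sgn_sqr (R := R) i => ss; rewrite -/(q i x).
  transitivity (a * (sgn i * sgn i)); last by rewrite ss mulr1.
  by field.
- by move=> j; rewrite (partial_lift j x) ipZl ipZr ip_normal_tangent !mulr0.
move=> O v oO Ox nv X /dXE ->.
have oOU : open (O `&` U) by exact: openI.
have nv' : normal_field (O `&` U) F v.
  by case: nv => sv nv; split=> [|y [Oy _]]; [apply: smooth_onS sv => ? []|exact: nv].
have [w sw vE] := normal_field_frame oOU (@subIsetr _ _ _) nv'.
have Ox' : (O `&` U) x by [].
have dv : differentiable v x by case: nv => sv _; exact: smooth_on_diff sv Ox.
have dw := smooth_on_diff sw Ox'.
rewrite linearZ /= -scaleNr tangent_partZ.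
have -> : 'd v x (delta_mx 0 i) = partial i v x by rewrite -(deriveE _ dv).
rewrite (partial_normal_field i oOU Ox' dw vE) (tangent_part_frame _ _ Ux).
rewrite ipZr ip_normal_normal (vE _ Ox') normal_col /normal_frame -mulmxA.
rewrite mul_col_mx mul0mx ip_frame_normal ip_deltar.
have tE s : P x *m col_mx (s *: delta_mx i 0) 0 = s *: e i x.
  by rewrite tangent_col scalemxAr scale_col_mx scaler0.
rewrite tE !scalerA; congr (_ *: _).
by field.
Qed.

(** Testing the shape operator on the normal field [u_i], for an [i] with
    [X 0 i != 0], already forces [X] to lie on the [i]-th coordinate axis. *)
Lemma principal_direction_lift x X : U x -> principal_direction F x ('d F x X) ->
  exists2 i, X 0 i != 0 & X = X 0 i *: delta_mx 0 i.
Proof.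
move=> Ux [w [E0 _ _ H]].
have X0 : X != 0 by apply: contraNneq E0 => ->; rewrite linear0.
have /rV0Pn [i Xi] := X0; exists i => //.
pose v y := normal_frame y *m (g2 y *m (delta_mx i 0 : 'cV[R]_n)).
have vE y : v y = u i y.
  rewrite /v /normal_frame normal_col -mulmxA mul_col_mx mul0mx mulKmx //.
  exact: in_O_unitmx (frame2_orth fr y).
have sw : smooth_on setT (fun y => g2 y *m (delta_mx i 0 : 'cV[R]_n)).
  apply: smooth_on_mulmx => //; [exact: frame2_smooth fr|exact: smooth_on_cst].
have sv : smooth_on setT v.
  apply: smooth_on_mulmx => //; exact: smooth_normal_frame.
have nv : normal_field setT F v.
  split=> // y _ j; rewrite vE (partial_lift j y) ipZr.
  by rewrite ip_normal_tangent mulr0.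
have dv : differentiable v x by exact: smooth_on_diff sv _.
have dw : differentiable (fun y => g2 y *m (delta_mx i 0 : 'cV[R]_n)) x.
  exact: smooth_on_diff sw _.
have tv j : tangent_part F x (partial j v x) = P x *m col_mx
    ((sgn j * (j == i)%:R) *: delta_mx j 0) 0.
  rewrite (partial_normal_field j oT (I : setT x) dw (fun y _ => erefl (v y))).
  rewrite (tangent_part_frame _ _ Ux) mulKmx; last first.
    exact: in_O_unitmx (frame2_orth fr x).
  by rewrite mxE andbT.
have := H setT v oT I nv X erefl.
have -> : - 'd v x X = \sum_j (- X 0 j) *: partial j v x.
  by rewrite (diff_partial X dv) -sumrN; apply: eq_bigr => j _; rewrite scaleNr.
have tsum (y : 'I_n -> 'cV[R]_(n + n)) :
    tangent_part F x (\sum_j y j) = \sum_j tangent_part F x (y j).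
  apply: (big_morph (tangent_part F x)) => [a b|].
    rewrite /tangent_part -big_split; apply: eq_bigr => l _ /=.
    by rewrite -big_split; apply: eq_bigr => m _ /=; rewrite ipDl mulrDr scalerDl.
  by rewrite -{1}(scale0r (0 : 'cV[R]_(n + n))) tangent_partZ scale0r.
rewrite tsum; under eq_bigr do rewrite tangent_partZ tv.
rewrite (bigD1 i) //= big1 ?addr0 => [|j ji]; last first.
  by rewrite (negPf ji) mulr0 scale0r col_mx0 mulmx0 scaler0.
rewrite eqxx mulr1 diff_lift !scalemxAr => /frame_inj.
rewrite !scale_col_mx => /eq_col_mx [/colP K _].
have KE j : - X 0 i * (sgn i * (j == i)%:R)
    = ip (v x) w * (X 0 j * (sgn j * q j x)).
  transitivity ((- X 0 i *: (sgn i *: (delta_mx i 0 : 'cV[R]_n))) j 0).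
    by rewrite !mxE eqxx andbT.
  by rewrite (K j) mxE; congr (_ * _); rewrite mxE.
apply/rowP => j; rewrite !mxE eqxx /=.
have [->|ji] := eqVneq j i; first by rewrite mulr1.
have ip0 : ip (v x) w != 0.
  apply/eqP => z; have := KE i; rewrite z eqxx mul0r mulr1 => /eqP.
  by rewrite mulf_eq0 oppr_eq0 (negPf Xi) (negPf (sgn_neq0 i)).
have := KE j; rewrite (negPf ji) !mulr0 => /esym /eqP.
rewrite !mulf_eq0 (negPf ip0) (negPf (sgn_neq0 j)) /= => /orP[/eqP //|].
by rewrite (negPf (Ux j)).
Qed.

End Lift.
End Geometry.

(** * Combescure and Christoffel transforms *)

Section Combescure.
Context {R : realType} {n : nat}.
Variables (P : 'rV[R]_n -> 'M[R]_(n + n)) (g1 g2 eta : 'rV[R]_n -> 'M[R]_n).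
Hypothesis n_gt0 : (0 < n)%N.
Hypothesis fr : frame_pair P g1 g2 eta.

Lemma diff_lift_axis c x i (a : R) : 'd (Fmap P g2 c) x (a *: delta_mx 0 i)
  = (a * (sgn i * qvec g2 c x i 0)) *: col (lshift n i) (P x).
Proof.
rewrite linearZ /=; have -> : 'd (Fmap P g2 c) x (delta_mx 0 i)
    = (sgn i * qvec g2 c x i 0) *: col (lshift n i) (P x).
  rewrite -(deriveE _ (differentiable_lift fr c x)); exact: partial_lift fr c i x.
by rewrite scalerA.
Qed.

Variables b c : 'cV[R]_n.
Variable V : set 'rV[R]_n.
Hypothesis VU : V `<=` regular_set g2 b `&` regular_set g2 c.

Let Vb : V `<=` regular_set g2 b := fun x Vx => (VU Vx).1.
Let Vc : V `<=` regular_set g2 c := fun x Vx => (VU Vx).2.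

Let immersed a : V `<=` regular_set g2 a ->
  [/\ immersion V (Fmap P g2 a), riemannian V (first_ff (Fmap P g2 a))
    & flat_normal_bundle V (Fmap P g2 a)].
Proof.
move=> Va; split; last exact: flat_normal_bundle_lift n_gt0 fr a V Va.
  split=> [|x Vx]; first exact: smooth_onS (smooth_lift fr a).
  exact: (immersive_lift fr a x).1 (Va x Vx).
have [sg pg] := riemannian_lift n_gt0 fr a.
split=> [|x Vx]; [exact: smooth_onS sg|exact: pg (Va x Vx)].
Qed.

Let diff_id (x X : 'rV[R]_n) : 'd (id : 'rV[R]_n -> 'rV[R]_n) x X = X.
Proof. by rewrite (@diff_val _ _ _ _ _ _ _ (is_diff_id x)). Qed.

Lemma combescure_lifts :
  combescure_transform V (Fmap P g2 c) V (Fmap P g2 b) id.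
Proof.
split; [exact: immersed Vc|exact: immersed Vb| |].
  by exists id; split=> //; exact: smooth_on_id.
move=> x X Vx pX; have [ i ] := principal_direction_lift n_gt0 fr (Vc Vx) pX.
move: {pX}(X 0 i) => a a0 ->.
rewrite (diff_id x (a *: delta_mx 0 i)).
(* In terms of the images D1 and D2 of one coordinate axis under both lifts. *)
have parallel (D1 D2 : 'cV[R]_(n + n)) :
    D1 = (a * (sgn i * qvec g2 b x i 0)) *: col (lshift n i) (P x) ->
    D2 = (a * (sgn i * qvec g2 c x i 0)) *: col (lshift n i) (P x) ->
    principal_direction (Fmap P g2 b) x D1 /\ exists k : R, D1 = k *: D2.
  move=> -> ->; split.
    exists (- (ip (col (rshift n i) (P x)) (col (rshift n i) (P x))
              * (qvec g2 b x i 0)^-1) *: col (rshift n i) (P x)).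
    have a'0 : a * (sgn i * qvec g2 b x i 0) != 0.
      by rewrite !mulf_neq0 ?sgn_neq0 //; exact: Vb.
    exact: (curvature_normal_lift n_gt0 fr i (Vb Vx) a'0).
  exists (qvec g2 b x i 0 / qvec g2 c x i 0); rewrite scalerA; congr (_ *: _).
  have q0 : qvec g2 c x i 0 != 0 by exact: Vc.
  by field.
by apply: parallel; exact: diff_lift_axis.
Qed.

Lemma orientation_reversing_lifts :
  (forall x, V x -> hprod (qvec g2 b x) * hprod (qvec g2 c x) < 0) ->
  orientation_reversing V (Fmap P g2 c) (Fmap P g2 b) id.
Proof.
move=> neg x Vx.
pose r i := qvec g2 b x i 0 / qvec g2 c x i 0.
exists (diag_mx (\row_i r i)); split=> [X|].
  rewrite (diff_id x X).
  apply: etrans (diff_lift fr b x X) _; apply: etrans _ (esym (diff_lift fr c x _)).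
  congr (_ *m col_mx _ _); apply/colP => i.
  rewrite mul_mx_diag [LHS]mxE [RHS]mxE [(\matrix_(_, _) _) _ _]mxE [(\row_i r i) _ _]mxE.
  have q0 : qvec g2 c x i 0 != 0 by exact: Vc.
  by rewrite /r; field.
rewrite det_diag; have -> : \prod_i (\row_i r i) 0 i
    = hprod (qvec g2 b x) * hprod (qvec g2 c x) / hprod (qvec g2 c x) ^+ 2.
  have c0 : hprod (qvec g2 c x) != 0.
    by apply/prodf_neq0 => i _; exact: Vc.
  have -> : \prod_i (\row_i r i) 0 i = hprod (qvec g2 b x) / hprod (qvec g2 c x).
    by rewrite /hprod -prodf_div; apply: eq_bigr => i _; rewrite mxE.
  by field.
rewrite pmulr_llt0; first exact: neg.
rewrite invr_gt0 exprn_even_gt0 //=.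
by apply/prodf_neq0 => i _; exact: Vc.
Qed.

End Combescure.

Theorem theorem3p2 (R : realType) (n : nat) (n_gt0 : (0 < n)%N)
    (t0 : 'cV[R]_(n + n)) (t0_unit : ip t0 t0 = -1)
    (Xi : 'rV[R]_n -> 'M[R]_(n + n)) (Xi_sol : UK_system Xi)
    (Phi : R[i] -> 'rV[R]_n -> 'M[R[i]]_(n + n))
    (Phi_frame : extended_flat_frame Xi Phi) :
  exists (P1 : 'rV[R]_n -> 'M[R]_(n + n)) (g1 g2 : 'rV[R]_n -> 'M[R]_n),
    let e (i : 'I_n) (x : 'rV[R]_n) := col (lshift n i) (P1 x) in
    let u (i : 'I_n) (x : 'rV[R]_n) := col (rshift n i) (P1 x) in
    [/\ forall x, Phi 1 x = toC (P1 x),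
        forall x, Phi 0 x = toC (block_mx (g1 x) 0 0 (g2 x)),
        forall c : 'cV[R]_n, c != 0 -> ip c c = 0 ->
          let F := Fmap P1 g2 c in
          let q (i : 'I_n) (x : 'rV[R]_n) := qvec g2 c x i 0 in
          [/\ (* F is a flat lift on the set where it is an immersion *)
              [/\ open (regular_set g2 c),
                  forall x, regular_set g2 c x <-> immersive_at F x
                & exists f : 'rV[R]_n -> 'cV[R]_(n + n),
                    conformally_flat_immersion t0 (regular_set g2 c) f /\
                    flat_lift t0 (regular_set g2 c) f F],
              (* (u_i, u_i) is 1 except for the last i, where it is -1 *)
              forall x, F x = \sum_(i < n) q i x *: u i x,
              forall x i j, first_ff F x i j = (q i x ^+ 2) *+ (i == j),
              forall x i j, regular_set g2 c x ->
                second_ff F x i j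
                = (- (ip (u i x) (u i x) * q i x) *: u i x) *+ (i == j)
            & forall x i, regular_set g2 c x ->
                curvature_normal F x (e i x)
                  (- (ip (u i x) (u i x) * (q i x)^-1) *: u i x)]
      & forall b c : 'cV[R]_n, b != 0 -> ip b b = 0 -> c != 0 -> ip c c = 0 ->
        forall V : set 'rV[R]_n, open V ->
          V `<=` regular_set g2 b `&` regular_set g2 c ->
          combescure_transform V (Fmap P1 g2 c) V (Fmap P1 g2 b) id /\
          ((forall x, V x ->
              hprod (qvec g2 b x) * hprod (qvec g2 c x) < 0) ->
           christoffel_transform V (Fmap P1 g2 c) V (Fmap P1 g2 b) id)].
Proof.
have [P [g1 [g2 [eta [fr PhiP Phig]]]]] :=
  frame_pair_of_extended n_gt0 Xi_sol Phi_frame.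
exists P, g1, g2; move=> e u; split; [exact: PhiP|exact: Phig| |].
  move=> c c0 cc F q; split.
  - split; [exact: (open_regular_set fr (c:=c))|exact: immersive_lift fr c|].
    by eexists; exact: (sphere_map_conformally_flat n_gt0 fr t0_unit c0 cc).
  - exact: lift_sum.
  - exact: first_ff_lift n_gt0 fr c.
  - exact: second_ff_lift n_gt0 fr c.
  move=> x i Ux; have := curvature_normal_lift n_gt0 fr i Ux (oner_neq0 R).
  by rewrite scale1r.
move=> b c _ _ _ _ V _ VU; have comb := combescure_lifts n_gt0 fr VU.
split; [exact: comb|move=> neg; split; first exact: comb].
exact: (orientation_reversing_lifts fr VU neg).
Qed.
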